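(* Let $C$ be a contraction on a Hilbert space $\mathcal{H}_C$, let $E=\begin{bmatrix} C & 0 \\ B & A \end{bmatrix}$ be a minimal contractive lifting of $C$ on $\mathcal{H}_E=\mathcal{H}_C\oplus\mathcal{H}_A$, and let $a\in\mathbb{D}$. Put $C_a=(C-aI)(I-\overline{a}C)^{-1}$ and $E_a=(E-aI)(I-\overline{a}E)^{-1}$ (a minimal contractive lifting of $C_a$). Then the symbol $\theta_{C_a,E_a}(\lambda)$ of the characteristic function of the lifting $E_a$ of $C_a$ coincides with $\theta_{C,E}(\mu)$, $\mu=\frac{\lambda+a}{1+\overline{a}\lambda}$; that is, there exist unitaries $u:\mathcal{D}_{E_a}\to\mathcal{D}_E$ and $w:\mathcal{D}_{C_a}\to\mathcal{D}_C$ such that $$w\,\theta_{C_a,E_a}(\lambda)=\theta_{C,E}\!\left(\frac{\lambda+a}{1+\overline{a}\lambda}\right)u\qquad\text{for all }\lambda\in\mathbb{D}.$$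
   Context: $\mathbb{D}$ is the open unit disc. For a contraction $T$: $D_T=(I-T^*T)^{1/2}$, $D_{*,T}=(I-TT^* )^{1/2}$, $\mathcal{D}_T=\overline{\mathrm{ran}}\,D_T$, $\mathcal{D}_{*,T}=\overline{\mathrm{ran}}\,D_{*,T}$. A contraction $E$ on $\mathcal{H}_E=\mathcal{H}_C\oplus\mathcal{H}_A$ is a contractive lifting of $C$ if it has the lower triangular form $E=\begin{bmatrix} C & 0 \\ B & A \end{bmatrix}$; it is minimal if $\mathcal{H}_E=\overline{\mathrm{span}}\{E^nx:x\in\mathcal{H}_C,n\ge0\}$. It is known that for a contractive lifting there is a unique contraction $\gamma:\mathcal{D}_{*,A}\to\mathcal{D}_C$ with $B^*=D_C\gamma D_{*,A}$. The symbol of the characteristic function of the lifting $E$ of $C$ is the analytic function $\lambda\mapsto\theta_{C,E}(\lambda)\in\mathcal{B}(\mathcal{D}_E,\mathcal{D}_C)$ on $\mathbb{D}$ determined by $$\theta_{C,E}(\lambda)D_Eh_c=D_Ch_c-\sum_{n\ge0}\lambda^n\gamma D_{*,A}A^{*n}Bh_c\quad(h_c\in\mathcal{H}_C),$$ $$\theta_{C,E}(\lambda)D_Eh_a=-\gamma AD_Ah_a+\sum_{n\ge0}\lambda^{n+1}\gamma D_{*,A}A^{*n}D_A^2h_a\quad(h_a\in\mathcal{H}_A).$$ The function $\theta_{C_a,E_a}$ is defined in the same way from the lifting $E_a$ of $C_a$. *)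

(* Defs.v *)
From HB Require Import structures.
From mathcomp Require Import all_boot all_order all_algebra.
From mathcomp Require Import complex.
From mathcomp Require Import boolp classical_sets functions reals topology.
From mathcomp Require Import normedtype sequences.
From mathcomp Require Import ring.

Set Implicit Arguments.
Unset Strict Implicit.
Unset Printing Implicit Defensive.

Import Order.TTheory GRing.Theory Num.Def Num.Theory.
Import numFieldNormedType.Exports.

Local Open Scope classical_set_scope.
Local Open Scope ring_scope.

(* Complex Hilbert spaces. As in sesquilinear.v, [inner] is linear in its first
   argument and conjugate-linear in the second one. *)
HB.mixin Record CompleteNormedModule_isHilbert (R : realType) H
    & CompleteNormedModule R[i] H := {
  inner : {dot H for @Num.conj R[i]};
  inner_norm : forall x : H, `|x| ^+ 2 = inner x x
}.

#[short(type="hilbertType")]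
HB.structure Definition Hilbert (R : realType) :=
  {H of CompleteNormedModule R[i] H & CompleteNormedModule_isHilbert R H}.

Arguments inner {R s} : rename.

HB.instance Definition _ (R : nzRingType) (U V : lmodType R) :=
  gen_eqMixin {linear U -> V}.
HB.instance Definition _ (R : nzRingType) (U V : lmodType R) :=
  gen_choiceMixin {linear U -> V}.

(* The Hilbert space direct sum; a copy of the product type, because the
   library norms products by the maximum of the norms. *)
Definition hsum (H K : Type) : Type := (H * K)%type.

Section HilbertSum.
Context {R : realType} (H K : hilbertType R).
Local Notation C := R[i].

HB.instance Definition _ := GRing.Lmodule.copy (hsum H K) (H * K)%type.

Definition hsum_norm (x : hsum H K) : C := sqrtC (`|x.1| ^+ 2 + `|x.2| ^+ 2).

Lemma hsum_norm_ge0 x : 0 <= hsum_norm x.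
Proof. by rewrite sqrtC_ge0 addr_ge0 ?exprn_ge0. Qed.

Lemma hsum_norm_sqr x : hsum_norm x ^+ 2 = `|x.1| ^+ 2 + `|x.2| ^+ 2.
Proof. exact: sqrtCK. Qed.

Lemma hsum_normD (x y : hsum H K) :
  hsum_norm (x + y) <= hsum_norm x + hsum_norm y.
Proof.
rewrite -ler_sqr ?nnegrE ?addr_ge0 ?hsum_norm_ge0// sqrrD !hsum_norm_sqr/=.
apply: (@le_trans _ _ ((`|x.1| + `|y.1|) ^+ 2 + (`|x.2| + `|y.2|) ^+ 2)).
  by apply: lerD; rewrite ler_sqr ?nnegrE ?addr_ge0// ler_normD.
set p := `|x.1|; set q := `|y.1|; set r := `|x.2|; set s := `|y.2|.
have -> : (p + q) ^+ 2 + (r + s) ^+ 2 =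
    p ^+ 2 + r ^+ 2 + (p * q + r * s) *+ 2 + (q ^+ 2 + s ^+ 2) by ring.
have p0 : 0 <= p by exact: normr_ge0.
have q0 : 0 <= q by exact: normr_ge0.
have r0 : 0 <= r by exact: normr_ge0.
have s0 : 0 <= s by exact: normr_ge0.
rewrite lerD2r lerD2l lerMn2r/=.
rewrite -ler_sqr ?nnegrE ?addr_ge0 ?mulr_ge0 ?hsum_norm_ge0// exprMn !hsum_norm_sqr.
rewrite -/p -/q -/r -/s -subr_ge0.
have -> : (p ^+ 2 + r ^+ 2) * (q ^+ 2 + s ^+ 2) - (p * q + r * s) ^+ 2 =
          (p * s - r * q) ^+ 2 by ring.
by rewrite real_exprn_even_ge0// rpredB// ger0_real// mulr_ge0.
Qed.

Lemma hsum_normZ (l : C) (x : hsum H K) : hsum_norm (l *: x) = `|l| * hsum_norm x.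
Proof.
rewrite /hsum_norm /= !normrZ !exprMn -mulrDr sqrtCM ?nnegrE ?exprn_ge0//;
  last by rewrite addr_ge0 ?exprn_ge0.
by rewrite sqrCK.
Qed.

Lemma hsum_norm_eq0 (x : hsum H K) : hsum_norm x = 0 -> x = 0.
Proof.
move=> /eqP; rewrite sqrtC_eq0 paddr_eq0 ?exprn_ge0// !sqrf_eq0 !normr_eq0.
by case: x => x1 x2 /= /andP[/eqP-> /eqP->].
Qed.

HB.instance Definition _ := Lmodule_isNormed.Build C (hsum H K)
  hsum_normD hsum_normZ hsum_norm_eq0.

Lemma le_hsum1 (x : hsum H K) : `|x.1| <= `|x|.
Proof.
by rewrite -ler_sqr ?nnegrE// hsum_norm_sqr lerDl exprn_ge0.
Qed.

Lemma le_hsum2 (x : hsum H K) : `|x.2| <= `|x|.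
Proof.
by rewrite -ler_sqr ?nnegrE// hsum_norm_sqr lerDr exprn_ge0.
Qed.

Lemma hsum_le (x : hsum H K) : `|x| <= `|x.1| + `|x.2|.
Proof.
rewrite -ler_sqr ?nnegrE ?addr_ge0// hsum_norm_sqr sqrrD.
by rewrite addrAC lerDl mulrn_wge0 ?mulr_ge0.
Qed.

Lemma hsum_complete (F : set_system (hsum H K)) :
  ProperFilter F -> cauchy F -> cvg F.
Proof.
move=> FF /cauchy_ballP Fc.
have /cauchy_ballP/cauchy_cvg/cvg_ex[/= a Fa] : cauchy_ball (fst @ F : set_system H).
  move=> e e0; have := Fc e e0; rewrite !near_simpl => Fe.
  rewrite near_map2.
  apply: filterS Fe => -[x y]; rewrite -!ball_normE /=; apply: le_lt_trans.
  exact: (le_hsum1 (x - y)).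
have /cauchy_ballP/cauchy_cvg/cvg_ex[/= b Fb] : cauchy_ball (snd @ F : set_system K).
  move=> e e0; have := Fc e e0; rewrite !near_simpl => Fe.
  rewrite near_map2.
  apply: filterS Fe => -[x y]; rewrite -!ball_normE /=; apply: le_lt_trans.
  exact: (le_hsum2 (x - y)).
apply/cvg_ex; exists ((a, b) : hsum H K); apply/cvgrPdist_lt => e e0.
have e20 : 0 < e / 2 by rewrite divr_gt0.
have /cvgrPdist_lt/(_ _ e20) Fa2 := Fa; have /cvgrPdist_lt/(_ _ e20) Fb2 := Fb.
near=> x; apply: le_lt_trans (hsum_le _) _; rewrite [e]splitr ltrD//=.
- by near: x.
- by near: x.
Unshelve. all: by end_near. Qed.

HB.instance Definition _ := Uniform_isComplete.Build (hsum H K) hsum_complete.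

Definition hsum_inner (x y : hsum H K) : C := inner x.1 y.1 + inner x.2 y.2.

Lemma hsum_inner_bilinear : bilinear_for
  (GRing.Scale.Law.clone _ _ ( *%R) _) (GRing.Scale.Law.clone _ _ (Num.conj \; *%R) _)
  hsum_inner.
Proof.
split=> [y|x] a u v; rewrite /hsum_inner /=.
  by rewrite !linearPl mulrDr addrACA.
by rewrite !linearPr mulrDr addrACA.
Qed.

HB.instance Definition _ := bilinear_isBilinear.Build C (hsum H K) (hsum H K) C
  _ _ hsum_inner hsum_inner_bilinear.

Lemma hsum_inner_herm x y :
  hsum_inner x y = (-1) ^+ false * Num.conj (hsum_inner y x).
Proof.
rewrite expr0 mul1r /hsum_inner rmorphD /=.
by rewrite [inner x.1 _]hermC [inner x.2 _]hermC !expr0 !mul1r.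
Qed.

HB.instance Definition _ := isHermitianSesquilinear.Build C (hsum H K) false
  Num.conj hsum_inner hsum_inner_herm.

Lemma hsum_inner_norm (x : hsum H K) : `|x| ^+ 2 = hsum_inner x x.
Proof. by rewrite hsum_norm_sqr !inner_norm. Qed.

Lemma hsum_inner_gt0 x : x != 0 -> 0 < hsum_inner x x.
Proof. by move=> x0; rewrite -hsum_inner_norm exprn_gt0// normr_gt0. Qed.

HB.instance Definition _ :=
  isDotProduct.Build C (hsum H K) hsum_inner hsum_inner_gt0.

HB.instance Definition _ := CompleteNormedModule_isHilbert.Build R (hsum H K)
  hsum_inner_norm.

End HilbertSum.

(* The closure of the range of [f], as a Hilbert space. *)
Section ClosedRange.
Context {R : realType} {H K : hilbertType R} (f : {linear H -> K}).
Local Notation C := R[i].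

Definition in_clran : {pred K} := mem (closure (range f)).

Record clran : Type := Clran { clran_val : K; _ : clran_val \in in_clran }.

Lemma in_clranP x : x \in in_clran <-> forall e : C, 0 < e ->
  exists y, `|x - f y| < e.
Proof.
split=> [/set_mem xR e e0|xR].
  have [_ [[y _ <-]]] := xR _ (nbhsx_ballx x _ e0).
  by rewrite -ball_normE; exists y.
apply/mem_set => B /nbhs_ballP[e /= e0 eB]; have [y xy] := xR _ e0.
by exists (f y); split; [exists y|apply: eB; rewrite -ball_normE].
Qed.

Lemma in_clran_submod : submod_closed in_clran.
Proof.
split=> [|a u v /in_clranP uR /in_clranP vR]; apply/in_clranP => e e0.
  by exists 0; rewrite linear0 subrr normr0.
have d0 : 0 < e / 2 by rewrite divr_gt0.
have a0 : 0 < `|a| + 1 by rewrite ltr_wpDl.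
have [y uy] := uR (e / 2 / (`|a| + 1)) (divr_gt0 d0 a0).
have [z vz] := vR _ d0; exists (a *: y + z); rewrite linearP.
rewrite opprD addrACA -scalerBr (le_lt_trans (ler_normD _ _))// [e]splitr.
rewrite ler_ltD// normrZ; apply: (@le_trans _ _ ((`|a| + 1) * `|u - f y|)).
  by rewrite ler_wpM2r// lerDl.
by rewrite mulrC -ler_pdivlMr// ltW.
Qed.

HB.instance Definition _ := GRing.isSubmodClosed.Build _ _ in_clran
  in_clran_submod.
HB.instance Definition _ := [isSub for clran_val].
HB.instance Definition _ := [Choice of clran by <:].
HB.instance Definition _ := [SubChoice_isSubLmodule of clran by <:].

Definition clran_norm (x : clran) : C := `|val x|.

Lemma clran_normD x y : clran_norm (x + y) <= clran_norm x + clran_norm y.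
Proof. exact: ler_normD. Qed.

Lemma clran_normZ (l : C) x : clran_norm (l *: x) = `|l| * clran_norm x.
Proof. exact: normrZ. Qed.

Lemma clran_norm_eq0 x : clran_norm x = 0 -> x = 0.
Proof. by move=> /normr0_eq0 x0; exact: val_inj. Qed.

HB.instance Definition _ := Lmodule_isNormed.Build C clran
  clran_normD clran_normZ clran_norm_eq0.

Lemma clran_complete (F : set_system clran) :
  ProperFilter F -> cauchy F -> cvg F.
Proof.
move=> FF /cauchy_ballP Fc.
have /cauchy_ballP/cauchy_cvg/cvg_ex[/= a Fa] :
    cauchy_ball (val @ F : set_system K).
  move=> e e0; have := Fc e e0; rewrite !near_simpl => Fe.
  by rewrite near_map2; apply: filterS Fe => -[x y]; rewrite -!ball_normE.
have aR : a \in in_clran.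
  apply/mem_set; apply: (closed_cvg (closure (range f)) _ _ _ Fa) => //.
    exact: closed_closure.
  by apply: nearW => x; apply/set_mem; exact: valP.
apply/cvg_ex; exists (Clran aR); apply/cvgrPdist_lt => e e0.
by move/cvgrPdist_lt : Fa => /(_ _ e0).
Qed.

HB.instance Definition _ := Uniform_isComplete.Build clran clran_complete.

Definition clran_inner (x y : clran) : C := inner (val x) (val y).

Lemma clran_inner_bilinear : bilinear_for
  (GRing.Scale.Law.clone _ _ ( *%R) _)
  (GRing.Scale.Law.clone _ _ (Num.conj \; *%R) _)
  clran_inner.
Proof.
by split=> [y|x] a u v; rewrite /clran_inner /= ?linearPl ?linearPr.
Qed.

HB.instance Definition _ := bilinear_isBilinear.Build C clran clran C
  _ _ clran_inner clran_inner_bilinear.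

Lemma clran_inner_herm x y :
  clran_inner x y = (-1) ^+ false * Num.conj (clran_inner y x).
Proof. exact: hermC. Qed.

HB.instance Definition _ := isHermitianSesquilinear.Build C clran false
  Num.conj clran_inner clran_inner_herm.

Lemma clran_inner_norm x : `|x| ^+ 2 = clran_inner x x.
Proof. exact: inner_norm. Qed.

Lemma clran_inner_gt0 x : x != 0 -> 0 < clran_inner x x.
Proof. by move=> x0; rewrite -clran_inner_norm exprn_gt0// normr_gt0. Qed.

HB.instance Definition _ :=
  isDotProduct.Build C clran clran_inner clran_inner_gt0.

HB.instance Definition _ := CompleteNormedModule_isHilbert.Build R clran
  clran_inner_norm.

Lemma corestr_subproof x : f x \in in_clran.
Proof. by apply/mem_set/subset_closure; exists x. Qed.

Definition corestr (x : H) : clran := Clran (corestr_subproof x).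

Lemma corestr_is_linear : linear corestr.
Proof. by move=> a x y; apply: val_inj; rewrite /= linearP. Qed.

HB.instance Definition _ :=
  GRing.isLinear.Build C H clran _ corestr corestr_is_linear.

End ClosedRange.

Section Operators.
Context {R : realType}.
Local Notation C := R[i].
Implicit Types H K : hilbertType R.

Definition contractive H K (T : H -> K) := forall x, `|T x| <= `|x|.

Definition unitary_op H K (T : H -> K) :=
  (forall x y, inner (T x) (T y) = inner x y) /\ range T = setT.

(* Operators below are given by definite descriptions: [xget \0 P] is the
   operator satisfying [P] (and [\0] should there be none). Existence is
   classical in each case the definition is meant for: [adjoint] of a bounded
   operator (Riesz), [psqrt] of a bounded positive operator, [opinv] of an
   invertible one. *)
Definition adjoint H K (T : {linear H -> K}) : {linear K -> H} :=
  xget (\0 : {linear K -> H}) [set S : {linear K -> H} |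
    forall x y, inner (T x) y = inner x (S y)].

Definition opinv H (T : {linear H -> H}) : {linear H -> H} :=
  xget (\0 : {linear H -> H}) [set S : {linear H -> H} | cancel S T /\ cancel T S].

Definition psqrt H (T : {linear H -> H}) : {linear H -> H} :=
  xget (\0 : {linear H -> H}) [set S : {linear H -> H} |
    [/\ continuous S, forall x, 0 <= inner (S x) x &
        forall x, S (S x) = T x]].

Definition defect H (T : {linear H -> H}) : {linear H -> H} :=
  psqrt (idfun \- (adjoint T \o T)).

Definition defect_star H (T : {linear H -> H}) : {linear H -> H} :=
  psqrt (idfun \- (T \o adjoint T)).

Definition defect_space H (T : {linear H -> H}) := clran (defect T).

Definition defect_star_space H (T : {linear H -> H}) := clran (defect_star T).

Definition moebius H (a : C) (T : {linear H -> H}) : {linear H -> H} :=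
  (T \- a \*: idfun) \o opinv (idfun \- a^* \*: T).

Definition lin_span H (A : set H) : set H :=
  [set v | exists n (c : 'I_n -> C) (x : 'I_n -> H),
    (forall i, A (x i)) /\ v = \sum_(i < n) c i *: x i].

End Operators.

Section Lifting.
Context {R : realType} {HC HA : hilbertType R}.
Local Notation K := R[i].
Local Notation HE := (hsum HC HA).
Implicit Types (C : {linear HC -> HC}) (E : {linear HE -> HE}).

Definition in1 (x : HC) : HE := (x, 0).
Definition in2 (y : HA) : HE := (0, y).

Definition blockB E (x : HC) : HA := (E (in1 x)).2.
Definition blockA E (y : HA) : HA := (E (in2 y)).2.

Lemma blockB_is_linear E : linear (blockB E).
Proof.
move=> a x y; rewrite /blockB -[_ *: (E _).2 + _]/((a *: E _ + E _).2).
by rewrite -linearP; congr (E _).2; congr pair; rewrite /= scaler0 addr0.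
Qed.
HB.instance Definition _ E :=
  GRing.isLinear.Build K HC HA _ (blockB E) (blockB_is_linear E).

Lemma blockA_is_linear E : linear (blockA E).
Proof.
move=> a x y; rewrite /blockA -[_ *: (E _).2 + _]/((a *: E _ + E _).2).
by rewrite -linearP; congr (E _).2; congr pair; rewrite /= scaler0 addr0.
Qed.
HB.instance Definition _ E :=
  GRing.isLinear.Build K HA HA _ (blockA E) (blockA_is_linear E).

(* E = [[C, 0], [B, A]] on HC (+) HA; the lower blocks are read off from E. *)
Definition is_lifting C E := forall h : HE,
  E h = (C h.1, blockB E h.1 + blockA E h.2).

Definition contractive_lifting C E := contractive E /\ is_lifting C E.

(* HC sits in HC (+) HA as the range of [in1]. *)
Definition minimal_lifting E :=
  closure (lin_span [set iter n E (in1 x) | n in [set: nat] & x in [set: HC]]) = setT.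

(* The contraction g with B^* = D_C g D_{*,A}. *)
Definition lifting_gamma C E :
    {linear defect_star_space (blockA E) -> defect_space C} :=
  xget (\0 : {linear defect_star_space (blockA E) -> defect_space C})
   [set g : {linear defect_star_space (blockA E) -> defect_space C} |
    contractive g /\
    forall y, adjoint (blockB E) y =
      defect C (val (g (corestr (defect_star (blockA E)) y)))].

(* The vectors D_E hc and D_E ha span a dense subspace of [defect_space E], so
   the two formulas determine a bounded operator. [insubd 0] injects the vector
   A D_A ha = D_{*,A} A ha, which lies in [defect_star_space A], into that
   subtype; its default value 0 plays no role. *)
Definition lifting_symbol C E (lam : K) :
    {linear defect_space E -> defect_space C} :=
  let A := blockA E in let B := blockB E in let g := lifting_gamma C E in
  let DsA := corestr (defect_star A) in
  xget (\0 : {linear defect_space E -> defect_space C})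
   [set Th : {linear defect_space E -> defect_space C} |
    [/\ continuous Th,
        forall hc : HC, Th (corestr (defect E) (in1 hc)) =
          corestr (defect C) hc -
          limn (series (fun n =>
            lam ^+ n *: g (DsA (iter n (adjoint A) (B hc))))) &
        forall ha : HA, Th (corestr (defect E) (in2 ha)) =
          - g (insubd 0 (A (defect A ha))) +
          limn (series (fun n => lam ^+ n.+1 *:
            g (DsA (iter n (adjoint A) (defect A (defect A ha))))))]].

End Lifting.

(* Main.v *)
(* Write [D_T] for the defect operator of [T] and [z'] for the conjugate of [z].
   Fix [lam] in the disc. For [x] in HC let [k] be the vector with [k.1 = x] and
   [k.2 = lam' (E k).2], i.e. [(I - lam' E) k = ((I - lam' C) x, 0)]. The defining
   formulas of the symbol say exactly that its adjoint maps [D_C x] to [D_E k];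
   since [|D_C x|^2 - |D_E k|^2 = (1 - |lam|^2) |(E k).2|^2], this is a
   contraction, so the symbol exists.

   For the Moebius transform [T_a] of [T] one has
   [|D_{T_a} (I - a' T) h|^2 = (1 - |a|^2) |D_T h|^2], whence a unitary
   [D_{T_a} (I - a' T) h |-> (1 - |a|^2)^(1/2) D_T h]; take [u] for [T = E] and
   [w] for [T = C]. If [k] is as above for [(E, mu)], then [(I - a' E) k] is the
   corresponding vector for [(E_a, lam)], because [mu' - a' = lam' (1 - a mu')].
   The intertwining relation follows by testing against the vectors [D_C x]. *)
From HB Require Import structures.
Require Import Defs.
From mathcomp Require Import all_boot all_order all_algebra complex.
From mathcomp Require Import boolp classical_sets functions reals topology.
From mathcomp Require Import normedtype sequences.
From mathcomp Require Import ring lra.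

Set Implicit Arguments.
Unset Strict Implicit.
Unset Printing Implicit Defensive.

Import Order.TTheory GRing.Theory Num.Def Num.Theory.
Import numFieldNormedType.Exports.

Local Open Scope classical_set_scope.
Local Open Scope ring_scope.

(** * Inner products *)

Section InnerProduct.
Context {R : realType} {H : hilbertType R}.
Local Notation K := R[i].
Implicit Types (x y z : H) (a : K).

Lemma innerDl x y z : inner (x + y) z = inner x z + inner y z.
Proof. exact: linearDl. Qed.

Lemma innerDr x y z : inner z (x + y) = inner z x + inner z y.
Proof. exact: linearDr. Qed.

Lemma innerBl x y z : inner (x - y) z = inner x z - inner y z.
Proof. exact: linearBl. Qed.

Lemma innerBr x y z : inner z (x - y) = inner z x - inner z y.
Proof. exact: linearBr. Qed.

Lemma innerNl x y : inner (- x) y = - inner x y.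
Proof. exact: linearNl. Qed.

Lemma innerNr x y : inner x (- y) = - inner x y.
Proof. exact: linearNr. Qed.

Lemma innerZl a x y : inner (a *: x) y = a * inner x y.
Proof. exact: linearZl_LR. Qed.

Lemma innerZr a x y : inner x (a *: y) = a^* * inner x y.
Proof. exact: linearZr_LR. Qed.

Lemma inner0l x : inner 0 x = 0.
Proof. exact: linear0l. Qed.

Lemma inner0r x : inner x 0 = 0.
Proof. exact: linear0r. Qed.

Lemma innerC x y : inner x y = (inner y x)^*.
Proof. by rewrite hermC expr0 mul1r. Qed.

Lemma innerE x : inner x x = `|x| ^+ 2.
Proof. by rewrite inner_norm. Qed.

Lemma inner_ge0 x : 0 <= inner x x.
Proof. by rewrite innerE exprn_ge0. Qed.

Lemma inner_eq0 x : inner x x = 0 -> x = 0.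
Proof. by rewrite innerE => /eqP; rewrite expf_eq0 normr_eq0 => /eqP. Qed.

Lemma inner_ext x y : (forall z, inner z x = inner z y) -> x = y.
Proof.
move=> xy; apply/eqP; rewrite -subr_eq0; apply/eqP/inner_eq0.
by rewrite innerBr xy subrr.
Qed.

Lemma ler_inner x y : `|inner x y| <= `|x| * `|y|.
Proof.
have [->|y0] := eqVneq y 0; first by rewrite inner0r !normr0 mulr0.
have ny : 0 < `|y| by rewrite normr_gt0.
rewrite -ler_sqr ?nnegrE ?mulr_ge0// exprMn -ler_pdivrMr ?exprn_gt0//.
have yy : inner y y != 0 by rewrite innerE expf_eq0 normr_eq0 (negPf y0).
(* The component of [x] orthogonal to [y] has nonnegative square norm. *)
have := inner_ge0 (x - (inner x y / inner y y) *: y).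
rewrite innerBl !innerBr !innerZl !innerZr (innerC y x) rmorphM/= fmorphV/=.
rewrite -[(inner y y)^*]innerC normCK -innerE -innerE => h; rewrite -subr_ge0.
apply: le_trans h _; rewrite le_eqVlt; apply/orP; left; apply/eqP; by field.
Qed.

End InnerProduct.

Section Polarization.
Context {R : realType} {H L : hilbertType R}.

Lemma contractiveP (T : H -> L) :
  contractive T <-> forall x, inner (T x) (T x) <= inner x x.
Proof. by split=> cT x; move: (cT x); rewrite !innerE ler_sqr ?nnegrE. Qed.

(* A form that vanishes on the diagonal vanishes, complex scalars being used to
   separate [inner (S x) y] from its transpose. *)
Lemma real_form_sym (S : {linear H -> H}) :
  (forall x, inner (S x) x \is Num.real) ->
  forall x y, inner (S x) y = inner x (S y).
Proof.
move=> Sr.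
have Sd x : inner (S x) x = inner x (S x).
  by rewrite [RHS]innerC (CrealP (Sr x)).
move=> x y; have := Sd (x + y); have := Sd (x + 'i *: y).
rewrite !(linearD S) !(linearZ_LR S)/=.
rewrite !innerDl !innerDr !innerZl !innerZr !Sd conjCi.
set p := inner (S x) y; set q := inner (S y) x.
set r := inner x (S y); set s := inner y (S x).
set u := inner x (S x); set v := inner y (S y) => e1 e2.
have pq : p + q = r + s.
  have -> : p + q = u + p + (q + v) - u - v by ring.
  by rewrite e2; ring.
have /(mulfI (neq0Ci _)) qp : 'i * (q - p) = 'i * (s - r).
  have -> : 'i * (q - p) = u + - 'i * p + ('i * q + 'i * (- 'i * v)) -
    (u + 'i * (- 'i * v)) by ring.
  by rewrite e1; ring.
have : (p - r) *+ 2 = 0.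
  have -> : (p - r) *+ 2 = p + q - (q - p) - r *+ 2 by ring.
  by rewrite pq qp; ring.
by move/eqP; rewrite mulrn_eq0 subr_eq0 => /eqP.
Qed.

End Polarization.

(** * Convergence criteria for sequences over [R[i]] *)

Section Convergence.
Context {R : realType}.
Local Notation K := R[i].
Local Notation toC := (real_complex R).

(** The order of [R[i]] compares only numbers with equal imaginary parts, so tolerances are real and
    estimates can be moved to [R], where bounded monotone sequences converge. *)
Lemma gt0_toC (e : K) : 0 < e -> exists2 r : R, 0 < r & e = toC r.
Proof.
move=> e0; have /complex_realP[r er] := gtr0_real e0.
by exists r => //; rewrite -ltcR -er.
Qed.

Lemma inv_succ_small (e : K) : 0 < e ->
  exists N : nat, forall n, (N <= n)%N -> n.+1%:R^-1 < e.
Proof.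
move=> /gt0_toC[r r0 ->]; exists (Num.truncn r^-1) => n Nn.
have rn : r^-1 < n.+1%:R.
  by apply: lt_le_trans (truncnS_gt _) _; rewrite ler_nat.
rewrite -(rmorph_nat toC) -fmorphV ltcR -[r]invrK.
by rewrite ltf_pV2 ?posrE ?invr_gt0 ?ltr0n.
Qed.

Lemma tail_cvg (V : completeNormedModType K) (u : nat -> V) :
  (forall e : K, 0 < e ->
    exists N, forall n, (N <= n)%N -> `|u N - u n| < e) -> cvgn u.
Proof.
move=> ut; apply/cauchy_cvgP/cauchy_exP => e e0; have [N uN] := ut e e0.
exists (u N); exists N => // n Nn; rewrite -ball_normE /=; exact: uN.
Qed.

(** The increments of [d] dominate norms, so [d] is nondecreasing; being bounded it converges, and
    telescoping makes [u] Cauchy. This serves both the Neumann series and the square root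
    iteration. *)
Lemma dominated_cvg (V : completeNormedModType K) (u : nat -> V)
    (d : nat -> R) (M : R) :
  (forall n, `|u n.+1 - u n| <= toC (d n.+1 - d n)) ->
  (forall n, d n <= M) -> cvgn u.
Proof.
move=> ud dM.
have d_nd : nondecreasing_seq d.
  apply/nondecreasing_seqP => n.
  by rewrite -subr_ge0 -ler0c (le_trans _ (ud n)).
have umn n m : `|u n - u (n + m)%N| <= toC (d (n + m)%N - d n).
  elim: m => [|m IH]; first by rewrite addn0 !subrr normr0.
  rewrite addnS -(subrK (u (n + m)%N) (u n)) -addrA.
  rewrite (le_trans (ler_normD _ _))//.
  have -> : d (n + m).+1 - d n =
      (d (n + m)%N - d n) + (d (n + m).+1 - d (n + m)%N).
    by ring.
  by rewrite rmorphD lerD// distrC; exact: ud.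
have : cvgn d.
  by apply: nondecreasing_is_cvgn => //; exists M => _ [n _ <-].
move=> dc; have dl := nondecreasing_cvgn_le d_nd dc.
apply: tail_cvg => e /gt0_toC[r r0 ->].
have /cvgrPdist_lt/(_ r r0)[N _ dN] := dc.
exists N => n Nn; rewrite -(subnKC Nn); apply: le_lt_trans (umn _ _) _.
rewrite ltcR subnKC//; apply: le_lt_trans (_ : limn d - d N < r).
  by rewrite lerD2r dl.
by apply: le_lt_trans (dN N (leqnn N)); exact: ler_norm.
Qed.

Lemma lim_norm_le (V : normedModType K) (u : nat -> V) (l : V) (M : K) :
  u @ \oo --> l -> (forall n, `|u n| <= M) -> `|l| <= M.
Proof.
move=> ul uM; apply/ler_addgt0Pr => e e0.
have /cvgrPdist_lt/(_ e e0)[N _ uN] := ul.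
have -> : l = u N + (l - u N) by rewrite addrC subrK.
rewrite (le_trans (ler_normD _ _))// lerD//.
exact: ltW (uN N (leqnn N)).
Qed.

Lemma lim_eq (V : normedModType K) (u : nat -> V) (l l' : V) :
  u @ \oo --> l -> u @ \oo --> l' -> l = l'.
Proof. move=> ul ul'; rewrite -(cvg_lim (@norm_hausdorff _ V) ul).
exact: (cvg_lim (@norm_hausdorff _ V) ul'). Qed.

Lemma contractive_cvg (V W : normedModType K) (f : {linear V -> W}) (T : Type)
    (F : set_system T) {FF : Filter F} (u : T -> V) (l : V) :
  (forall x, `|f x| <= `|x|) -> u @ F --> l -> (f \o u) @ F --> f l.
Proof.
move=> cf /cvgrPdist_lt ul; apply/cvgrPdist_lt => e e0.
by apply: filterS (ul e e0) => x; rewrite /= -linearB; exact: le_lt_trans.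
Qed.

Lemma contractive_continuous (V W : normedModType K) (f : {linear V -> W}) :
  (forall x, `|f x| <= `|x|) -> continuous f.
Proof. by move=> cf x; exact: contractive_cvg cf _. Qed.

End Convergence.

(** * Riesz representation and closed ranges *)

Section Riesz.
Context {R : realType}.
Local Notation K := R[i].
Local Notation toC := (real_complex R).

Lemma inner_cvgr (H : hilbertType R) (z : H) (u : nat -> H) (l : H) :
  u @ \oo --> l -> inner z (u n) @[n --> \oo] --> inner z l.
Proof.
move=> /cvgrPdist_lt ul; apply/cvgrPdist_lt => e e0.
have z0 : 0 < `|z| + 1 by rewrite ltr_wpDl.
apply: filterS (ul (e / (`|z| + 1)) (divr_gt0 e0 z0)) => n un.
rewrite -innerBr (le_lt_trans (ler_inner _ _))//.
apply: (@le_lt_trans _ _ ((`|z| + 1) * `|l - u n|)).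
  by rewrite ler_wpM2r// lerDl.
by rewrite mulrC -ltr_pdivlMr.
Qed.

Lemma inner_cvgl (H : hilbertType R) (z : H) (u : nat -> H) (l : H) :
  u @ \oo --> l -> inner (u n) z @[n --> \oo] --> inner l z.
Proof.
move=> /(inner_cvgr (z := z))/cvgrPdist_lt ul; apply/cvgrPdist_lt => e e0.
apply: filterS (ul e e0) => n.
by rewrite -innerBr -innerBl innerC norm_conjC.
Qed.

Lemma real_inf (T : Type) (x0 : T) (J : T -> K) (M : K) :
  (forall x, J x \is Num.real) -> M \is Num.real -> (forall x, M <= J x) ->
  exists m, (forall x, m <= J x) /\ forall e, 0 < e -> exists x, J x < m + e.
Proof.
move=> Jr /complex_realP[b ->] JM.
pose A : set R := [set y | exists x, J x = toC y].
have A0 : A !=set0 by have /complex_realP[y] := Jr x0; exists y, x0.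
have Ab : has_inf A.
  by split => //; exists b => y [x xy]; move: (JM x); rewrite xy lecR.
exists (toC (inf A)); split => [x|e /gt0_toC[r r0 ->]].
  have /complex_realP[y xy] := Jr x; rewrite xy lecR.
  by apply: (ge_inf Ab.2); exists x.
have [y [x xy] yr] := inf_adherent r0 Ab.
by exists x; rewrite xy -rmorphD ltcR.
Qed.

(* The minimum of [|f x|^2 - 2 Re (phi x)] need not be attained, but the images
   under [f] of a minimising sequence converge. *)
Lemma riesz_range (H L : hilbertType R) (f : {linear H -> L}) (phi : {scalar H})
    (M : K) : 0 <= M -> (forall x, `|phi x| <= M * `|f x|) ->
  exists2 v, v \in in_clran f & forall x, phi x = inner (f x) v.
Proof.
move=> M0 phiM.
(* The functional to be minimised; completing the square bounds it below by [- M ^+ 2]. *)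
pose J x : K := inner (f x) (f x) - (phi x + (phi x)^*).
have Jr x : J x \is Num.real.
  by rewrite /J CrealE rmorphB rmorphD/= conjCK -innerC [phi x + _]addrC.
have Jge x : - M ^+ 2 <= J x.
  have h : phi x + (phi x)^* <= 2 * M * `|f x|.
    have r : phi x + (phi x)^* \is Num.real.
      by rewrite CrealE rmorphD/= conjCK addrC.
    rewrite (le_trans (real_ler_norm r))// (le_trans (ler_normD _ _))//.
    by rewrite norm_conjC -mulr2n -[leLHS]mulr_natl -mulrA ler_wpM2l.
  rewrite /J innerE -subr_ge0.
  apply: (@le_trans _ _ ((M - `|f x|) ^+ 2)).
    by rewrite real_exprn_even_ge0// rpredB// ger0_real.
  rewrite -subr_ge0 (_ : _ - _ = 2 * M * `|f x| - (phi x + (phi x)^*)).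
    by rewrite subr_ge0.
  by ring.
have Mr : - M ^+ 2 \is Num.real by rewrite rpredN rpredX// ger0_real.
have [m [Jm mJ]] := real_inf 0 Jr Mr Jge.
(* The terms in [phi] cancel. As [J] is at least [m] at the midpoint, near-minimisers have close
   images under [f]. *)
have parallelogram x y :
    `|f x - f y| ^+ 2 = 2 * J x + 2 * J y - 4 * J (2^-1 *: (x + y)).
  rewrite -innerE /J !(linearZ_LR f) !(linearZ_LR phi).
  rewrite !(linearD f) !(linearD phi)/=.
  rewrite !innerBl !innerBr !innerZl !innerZr !innerDl !innerDr.
  rewrite !(rmorphM, rmorphD, fmorphV, rmorph_nat)/=.
  by field.
have {mJ} /choice[x_ x_m] n : exists x, J x < m + n.+1%:R^-1.
  by apply: mJ; rewrite invr_gt0.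
have x_cauchy n p : (n <= p)%N -> `|f (x_ n) - f (x_ p)| ^+ 2 <= 4 * n.+1%:R^-1.
  move=> np; rewrite parallelogram.
  have Jp : J (x_ p) <= m + n.+1%:R^-1.
    apply: le_trans (ltW (x_m p)) _; rewrite lerD2l lef_pV2 ?posrE//.
    by rewrite ler_nat.
  have -> : 4 * n.+1%:R^-1 =
      2 * (m + n.+1%:R^-1) + 2 * (m + n.+1%:R^-1) - 4 * m :> K by ring.
  by rewrite lerB ?lerD ?ler_wpM2l ?(ltW (x_m n)).
have /cvg_ex[/= v xv] : cvgn (f \o x_).
  apply: tail_cvg => e e0.
  have [N eN] := inv_succ_small (divr_gt0 (exprn_gt0 2 e0) (ltr0n K 4)).
  exists N => n Nn; rewrite -ltr_sqr ?nnegrE ?(ltW e0)//.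
  rewrite (le_lt_trans (x_cauchy _ _ Nn))// mulrC -ltr_pdivlMr//.
  exact: eN.
exists v.
  apply/in_clranP => e e0; have /cvgrPdist_lt/(_ e e0)[N _ vN] := xv.
  by exists (x_ N); exact: vN (leqnn N).
move=> x.
have xl := inner_cvgr (z := f x) xv.
suff xr : inner (f x) (f (x_ n)) @[n --> \oo] --> phi x.
  exact: (@lim_eq _ K^o (fun n => inner (f x) (f (x_ n))) _ _ xr xl).
pose q := `|f x| ^+ 2 + 1; have q0 : 0 < q by rewrite ltr_wpDl// exprn_ge0.
have c_le n : `|inner (f x) (f (x_ n)) - phi x| ^+ 2 <= n.+1%:R^-1 * q.
  set c := inner _ _ - _.
  have qr : q^* = q by apply: CrealP; exact: gtr0_real.
  have Jw w : J (x_ n + w *: x) =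
      J (x_ n) + w * c + w^* * c^* + w * w^* * inner (f x) (f x).
    have -> : c^* = inner (f (x_ n)) (f x) - (phi x)^*.
      by rewrite rmorphB/= -innerC.
    rewrite /J !(linearD f) !(linearD phi) !(linearZ_LR f) !(linearZ_LR phi)/=.
    rewrite !innerDl !innerDr !innerZl !innerZr rmorphD rmorphM/= /c.
    by ring.
  have Jc : J (x_ n + (- (q^-1 * c^*)) *: x) =
      J (x_ n) - q^-1 * `|c| ^+ 2 - (q^-1 * `|c|) ^+ 2.
    have -> : J (x_ n + (- (q^-1 * c^*)) *: x) =
        J (x_ n) - 2 * q^-1 * `|c| ^+ 2 +
        q^-1 ^+ 2 * `|c| ^+ 2 * inner (f x) (f x).
      rewrite Jw (rmorphN _ (q^-1 * c^*)) (rmorphM _ q^-1) (fmorphV _ q)/= qr.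
      by rewrite conjCK normCK; ring.
    have -> : inner (f x) (f x) = q - 1 by rewrite innerE /q addrK.
    by field; rewrite gt_eqF.
  have := Jm (x_ n + (- (q^-1 * c^*)) *: x).
  rewrite Jc lerBrDr => h1.
  have h2 : m + q^-1 * `|c| ^+ 2 < m + n.+1%:R^-1.
    apply: le_lt_trans (x_m n); rewrite -lerBrDr; apply: le_trans _ h1.
    by rewrite lerDl exprn_ge0// mulr_ge0// invr_ge0 ltW.
  by move: h2; rewrite ltrD2l mulrC ltr_pdivrMr// => /ltW.
apply/cvgrPdist_lt => e e0.
have [N eN] := inv_succ_small (divr_gt0 (exprn_gt0 2 e0) q0).
exists N => // n /= Nn; rewrite distrC -ltr_sqr ?nnegrE ?(ltW e0)//.
by rewrite (le_lt_trans (c_le n))// -ltr_pdivlMr// eN.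
Qed.

End Riesz.

Section LinearPacking.
Context {R : realType}.

Lemma linear_of (V W : lmodType R[i]) (f : V -> W) :
  linear f -> exists g : {linear V -> W}, forall x, g x = f x.
Proof.
move=> lf.
by exists (HB.pack f (GRing.isLinear.Build R[i] V W _ f lf) : {linear V -> W}).
Qed.

Lemma riesz_clran (H L : hilbertType R) (f : {linear H -> L}) (phi : H -> R[i])
    (M : R[i]) :
  scalar phi -> 0 <= M -> (forall x, `|phi x| <= M * `|f x|) ->
  exists v : clran f, forall x, phi x = inner (f x) (val v).
Proof.
move=> lphi M0 phiM.
pose p : {scalar H} := HB.pack phi (GRing.isLinear.Build R[i] H R[i] _ phi lphi).
by have [v vf pv] := @riesz_range R H L f p M M0 phiM; exists (Clran vf).
Qed.

End LinearPacking.

Section ClosedRange.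
Context {R : realType} {H L : hilbertType R} (f : {linear H -> L}).
Local Notation K := R[i].

Lemma clran_dense (z : clran f) (e : K) : 0 < e ->
  exists y, `|z - corestr f y| < e.
Proof. by move=> e0; have /in_clranP/(_ e e0) := valP z. Qed.

Lemma clran_seq (z : clran f) :
  exists y : nat -> H, corestr f (y n) @[n --> \oo] --> z.
Proof.
have /choice[y yz] (n : nat) : exists y, `|z - corestr f y| < n.+1%:R^-1.
  by apply: clran_dense; rewrite invr_gt0.
exists y; apply/cvgrPdist_lt => e /inv_succ_small[N eN].
by exists N => // n Nn; exact: lt_trans (yz n) (eN n Nn).
Qed.

(** By density of the range, [v] can be replaced by some [f y] in the first slot of [inner v v], at
    an arbitrarily small cost. *)
Lemma clran_norm_le (v : clran f) (M : K) : 0 <= M ->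
  (forall x, `|inner (f x) (val v)| <= M * `|f x|) -> `|v| <= M.
Proof.
move=> M0 vM.
have [->|v0] := eqVneq v 0; first by rewrite normr0.
have vp : 0 < `|v| by rewrite normr_gt0.
rewrite -(ler_pM2r vp) -expr2 inner_norm.
apply/ler_addgt0Pr => e e0.
have c0 : 0 < M + `|v| by rewrite ltr_wpDl.
(* With [v] approximated up to [d = e / (M + |v|)], the two errors [M * d] and [d * |v|] add up to
   exactly [e]. *)
have d0 := divr_gt0 e0 c0.
have [y yv] := clran_dense v d0.
have -> : inner v v = inner (f y) (val v) + inner (v - corestr f y) v.
  by rewrite innerBl addrC subrK.
have vvr : 0 <= inner (f y) (val v) + inner (v - corestr f y) v.
  rewrite (_ : _ + _ = inner v v) ?inner_ge0//.
  by rewrite innerBl addrC subrK.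
rewrite -(ger0_norm vvr) (le_trans (ler_normD _ _))//.
have fy : `|f y| <= `|v| + e / (M + `|v|).
  rewrite -[`|f y|]/(`|corestr f y|) -[corestr f y](subrK v) addrC.
  by rewrite (le_trans (ler_normD _ _))// lerD2l distrC ltW.
apply: (@le_trans _ _ (M * (`|v| + e / (M + `|v|)) + e / (M + `|v|) * `|v|)).
  rewrite lerD//; first by rewrite (le_trans (vM y))// ler_wpM2l.
  by rewrite (le_trans (ler_inner _ _))// ler_wpM2r// ltW.
by rewrite le_eqVlt; apply/orP; left; apply/eqP; field; rewrite gt_eqF.
Qed.

Lemma clran_ext (u v : clran f) :
  (forall x, inner (f x) (val u) = inner (f x) (val v)) -> u = v.
Proof.
move=> uv; apply/eqP; rewrite -subr_eq0 -normr_le0; apply: clran_norm_le => // x.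
by rewrite innerBr uv subrr normr0 mul0r.
Qed.

Lemma clran_linear_ext (V : normedModType K) (F G : {linear clran f -> V}) :
  continuous F -> continuous G ->
  (forall y, F (corestr f y) = G (corestr f y)) -> forall z, F z = G z.
Proof.
move=> cF cG FG z; have [y yz] := clran_seq z.
have Fz : F (corestr f (y n)) @[n --> \oo] --> F z.
  exact: (continuous_cvg _ (cF z) yz).
apply: lim_eq Fz _; under eq_fun do rewrite FG.
exact: (continuous_cvg _ (cG z) yz).
Qed.

(** Extension by continuity: the value at [z] is the limit of [f0 (y n)] along any sequence with
    [f (y n)] tending to [z]. *)
Lemma clran_extend (V : completeNormedModType K) (f0 : {linear H -> V}) :
  (forall y, `|f0 y| <= `|f y|) ->
  exists G : {linear clran f -> V},
    (forall z, `|G z| <= `|z|) /\ forall y, G (corestr f y) = f0 y.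
Proof.
move=> f0f.
(* Applied to differences of sequences, this makes the limit independent of the approximating
   sequence. *)
have null y : corestr f (y n) @[n --> \oo] --> (0 : clran f) ->
    f0 (y n) @[n --> \oo] --> (0 : V).
  move=> /cvgrPdist_lt y0; apply/cvgrPdist_lt => e e0.
  apply: filterS (y0 e e0) => n; rewrite !sub0r !normrN.
  exact: le_lt_trans.
have /choice[G GP] (z : clran f) : exists w : V, forall y : nat -> H,
    corestr f (y n) @[n --> \oo] --> z -> f0 (y n) @[n --> \oo] --> w.
  have [y yz] := clran_seq z.
  have /cvg_ex[/= w yw] : cvgn (f0 \o y).
    apply: tail_cvg => e e0; have e20 : 0 < e / 2 by rewrite divr_gt0.
    have /cvgrPdist_lt/(_ _ e20)[N _ yN] := yz.
    exists N => n Nn; rewrite /= -linearB (le_lt_trans (f0f _))//.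
    rewrite -[f _]/(val (corestr f _)) -[`|_|]/(`|corestr f (y N - y n)|).
    rewrite linearB/= -(subrK z (corestr f (y N))) -addrA.
    rewrite (le_lt_trans (ler_normD _ _))// [e]splitr ltrD ?yN//.
    by rewrite distrC; exact: (yN N (leqnn N)).
  exists w => y' y'z; rewrite -[w]add0r.
  have -> : (fun n => f0 (y' n)) = (fun n => f0 (y' n - y n) + f0 (y n)).
    by apply/funext => n; rewrite linearB subrK.
  apply: cvgD yw; apply: null; rewrite -(subrr z).
  have -> : (fun n => corestr f (y' n - y n)) =
      (fun n => corestr f (y' n) - corestr f (y n)).
    by apply/funext => n; rewrite linearB.
  exact: cvgB.
have Glin : linear G.
  move=> a u v; have [yu yuP] := clran_seq u; have [yv yvP] := clran_seq v.
  apply: (lim_eq (GP _ (fun n => a *: yu n + yv n) _)).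
    have -> : (fun n => corestr f (a *: yu n + yv n)) =
        (fun n => a *: corestr f (yu n) + corestr f (yv n)).
      by apply/funext => n; rewrite linearP.
    exact: cvgD (cvgZl_tmp yuP) yvP.
  have -> : (fun n => f0 (a *: yu n + yv n)) =
      (fun n => a *: f0 (yu n) + f0 (yv n)).
    by apply/funext => n; rewrite linearP.
  exact: cvgD (cvgZl_tmp (GP u yu yuP)) (GP v yv yvP).
have [G' G'E] := linear_of Glin; exists G'; split => [z|y]; rewrite G'E.
  have [y yz] := clran_seq z; have yG := GP z y yz.
  apply/ler_addgt0Pr => e e0; have e20 : 0 < e / 2 by rewrite divr_gt0.
  have /cvgrPdist_lt/(_ _ e20)[N _ yN] := yz.
  have /cvgrPdist_lt/(_ _ e20)[M _ yM] := yG.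
  pose n := maxn N M.
  have h1 := ltW (yN n (leq_maxl N M)); have h2 := ltW (yM n (leq_maxr N M)).
  rewrite -(subrK (f0 (y n)) (G z)) (le_trans (ler_normD _ _))//.
  rewrite [e]splitr addrCA lerD//; apply: le_trans (f0f _) _.
  rewrite -[`|f _|]/(`|corestr f (y n)|).
  have -> : corestr f (y n) = z + (corestr f (y n) - z) by rewrite addrC subrK.
  by rewrite (le_trans (ler_normD _ _))// lerD2l distrC.
have cy : (fun _ : nat => corestr f y) @ \oo --> corestr f y by exact: cvg_cst.
apply: (lim_eq (GP _ _ cy)); exact: cvg_cst.
Qed.

End ClosedRange.

(** * Adjoints, resolvents and square roots *)

Section Factor.
Context {R : realType}.
Local Notation K := R[i].

(** For fixed [y], Riesz representation in [clran f] gives a vector of norm at most [|g y|]; it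
    depends linearly on [y], so it extends to a contraction on [clran g]. The contraction gamma of a
    lifting arises in this way. *)
Lemma form_factor (H1 H2 L1 L2 : hilbertType R) (f : {linear H1 -> L1})
    (g : {linear H2 -> L2}) (S : H2 -> H1) :
  linear S -> (forall x y, `|inner x (S y)| <= `|f x| * `|g y|) ->
  exists G : {linear clran g -> clran f}, contractive G /\
    forall x y, inner x (S y) = inner (f x) (val (G (corestr g y))).
Proof.
move=> Slin Sfg.
have /choice[G0 G0P] y : exists v : clran f,
    forall x, inner x (S y) = inner (f x) (val v).
  apply: (riesz_clran (M := `|g y|)) => // [a u v|x].
    by rewrite innerDl innerZl.
  by rewrite mulrC.
have G0lin : linear G0.
  move=> a u v; apply: clran_ext => x.
  by rewrite -G0P Slin !(innerDr, innerZr) -!G0P.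
have [G1 G1E] := linear_of G0lin.
have G1g y : `|G1 y| <= `|g y|.
  by apply: clran_norm_le => // x; rewrite G1E -G0P mulrC.
have [G [Gc Gg]] := clran_extend G1g.
by exists G; split => // x y; rewrite Gg G1E.
Qed.

(** Riesz representation with [f] the identity shows that the description defining [adjoint] is
    satisfiable. *)
Lemma adjointP (H L : hilbertType R) (T : {linear H -> L}) : contractive T ->
  forall x y, inner (T x) y = inner x (adjoint T y).
Proof.
move=> cT.
pose A := [set S : {linear L -> H} | forall x y, inner (T x) y = inner x (S y)].
suff : A !=set0 by move=> /(xgetPex (\0 : {linear L -> H})).
have /choice[S SP] y : exists v, forall x, inner (T x) y = inner x v.
  have [a u v||x|v vP] := @riesz_clran R H H idfun (fun x => inner (T x) y) `|y|.
  - by rewrite linearP innerDl innerZl.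
  - by [].
  - by rewrite (le_trans (ler_inner _ _))// mulrC ler_wpM2l.
  by exists (val v).
have Slin : linear S.
  move=> a u v; apply: inner_ext => x.
  by rewrite !(innerDr, innerZr) -!SP !(innerDr, innerZr).
have [S' S'E] := linear_of Slin.
by exists S' => x y; rewrite S'E.
Qed.

Lemma adjointC (H L : hilbertType R) (T : {linear H -> L}) : contractive T ->
  forall x y, inner y (T x) = inner (adjoint T y) x.
Proof. by move=> cT x y; rewrite innerC (adjointP cT) -innerC. Qed.

Lemma adjoint_contractive (H L : hilbertType R) (T : {linear H -> L}) :
  contractive T -> contractive (adjoint T).
Proof.
move=> cT y; have [->|y0] := eqVneq (adjoint T y) 0; first by rewrite normr0.
have yp : 0 < `|adjoint T y| by rewrite normr_gt0.
(* Cauchy-Schwarz in [|T^* y|^2 = <T T^* y, y>], then division by [|T^* y|]. *)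
rewrite -(ler_pM2l yp) -expr2 -innerE -(adjointP cT).
have -> : inner (T (adjoint T y)) y = `|inner (T (adjoint T y)) y|.
  by rewrite ger0_norm// (adjointP cT) inner_ge0.
by rewrite (le_trans (ler_inner _ _))// ler_wpM2r.
Qed.

End Factor.

(** * Neumann series and resolvents *)

Section Neumann.
Context {R : realType} {H : hilbertType R}.
Local Notation K := R[i].
Implicit Types T : {linear H -> H}.

Lemma iter_contractive T : contractive T -> forall n x, `|iter n T x| <= `|x|.
Proof.
by move=> cT; elim=> [|n IH] x //=; rewrite (le_trans (cT _))// IH.
Qed.

(** Domination by the geometric series of ratio [|l|], scaled by [|x|]. The conclusion keeps the
    series because the symbol is defined by sums of this shape. *)
Lemma neumann_cvg T (l : K) : contractive T -> `|l| < 1 -> forall x,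
  exists z, series (fun n => l ^+ n *: iter n T x) @ \oo --> z /\
    z - l *: T z = x.
Proof.
move=> cT l1 x.
have /complex_realP[r lr] : `|l| \is Num.real by exact: normr_real.
have /complex_realP[s xs] : `|x| \is Num.real by exact: normr_real.
have r0 : 0 <= r by rewrite -ler0c -lr.
have s0 : 0 <= s by rewrite -ler0c -xs.
have r1 : 0 < 1 - r.
  by rewrite subr_gt0 -ltcR -lr.
have Ec : (1 - r) != 0 by rewrite gt_eqF.
have /cvg_ex[/= z zP] : cvgn (series (fun n => l ^+ n *: iter n T x)).
  apply: (@dominated_cvg _ _ _ (fun n => s * (1 - r ^+ n) / (1 - r))
                               (s / (1 - r))).
    move=> n; rewrite /series/= big_nat_recr//= addrAC subrr add0r.
    rewrite normrZ normrX lr.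
    have -> : s * (1 - r ^+ n.+1) / (1 - r) - s * (1 - r ^+ n) / (1 - r) =
        r ^+ n * s.
      by rewrite exprS; field.
    rewrite rmorphM rmorphXn/= -xs ler_wpM2l ?exprn_ge0 ?ler0c//.
    exact: iter_contractive.
  move=> n; rewrite ler_pM2r ?invr_gt0// -[leRHS]mulr1 ler_wpM2l//.
  by rewrite lerBlDr lerDl exprn_ge0.
exists z; split => //.
have Tz : T (series (fun n => l ^+ n *: iter n T x) n) @[n --> \oo] --> T z.
  exact: contractive_cvg cT zP.
have S1 : series (fun n => l ^+ n *: iter n T x) n.+1 @[n --> \oo] --> z.
  by rewrite -cvg_shiftS in zP.
(* Pass to the limit in [s (n+1) = x + l T (s n)] for the partial sums [s]. *)
suff e : z = x + l *: T z by rewrite {1}e addrK.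
apply: lim_eq S1 _.
  have -> : (fun n => series (fun n => l ^+ n *: iter n T x) n.+1) =
     (fun n => x + l *: T (series (fun n => l ^+ n *: iter n T x) n)).
    apply/funext => n; rewrite /series/= big_nat_recl//= expr0 scale1r.
    congr (_ + _).
    rewrite linear_sum scaler_sumr; apply: eq_bigr => i _.
    by rewrite linearZ/= scalerA exprS.
  exact: cvgD (cvg_cst _) (cvgZl_tmp Tz).
Qed.

Lemma neumann_inj T (l : K) : contractive T -> `|l| < 1 ->
  forall x y, x - l *: T x = y - l *: T y -> x = y.
Proof.
move=> cT l1 x y xy; apply/eqP; rewrite -subr_eq0.
have e : x - y = l *: T (x - y).
  rewrite linearB scalerBr; apply/eqP.
  by rewrite subr_eq -addrA addrC -subr_eq xy addrC.
apply: contraTT l1 => xy0; rewrite -real_leNgt ?normr_real//.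
have np : 0 < `|x - y| by rewrite normr_gt0.
by rewrite -(ler_pM2r np) mul1r {1}e normrZ ler_wpM2l.
Qed.

(** The Neumann sums give a right inverse; its linearity and the left inverse law follow from
    injectivity. *)
Lemma opinvP T (l : K) : contractive T -> `|l| < 1 ->
  (forall x, opinv (idfun \- l \*: T) x -
    l *: T (opinv (idfun \- l \*: T) x) = x) /\
  forall x, opinv (idfun \- l \*: T) (x - l *: T x) = x.
Proof.
move=> cT l1.
pose A := [set S : {linear H -> H} |
  cancel S (idfun \- l \*: T) /\ cancel (idfun \- l \*: T) S].
suff : A !=set0 by move=> /(xgetPex (\0 : {linear H -> H})) [].
have /choice[S SP] x : exists z, z - l *: T z = x.
  by have [z [_ zx]] := neumann_cvg cT l1 x; exists z.
have Slin : linear S.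
  move=> a u v; apply: (neumann_inj cT l1); rewrite SP linearP.
  rewrite -{1}(SP u) -{1}(SP v) scalerBr scalerDr !scalerA [l * a]mulrC.
  by rewrite opprD addrACA.
have [S' S'E] := linear_of Slin; exists S'; split => x /=.
  by rewrite S'E SP.
by rewrite S'E; apply: (neumann_inj cT l1); rewrite SP.
Qed.

End Neumann.

(** * Square roots of [1 - Y] for a positive contraction [Y] *)

Section SquareRoot.
Context {R : realType} {H : hilbertType R}.
Local Notation K := R[i].
Local Notation toC := (real_complex R).
Variable Y : {linear H -> H}.

(* Visser's iteration for [1 - sqrt (1 - Y)]; its scalar counterpart at [Y = 1]
   dominates the norms of the increments, so that no positivity of [Y] is needed
   for convergence. *)
Fixpoint visser n (x : H) : H :=
  if n is m.+1 then 2^-1 *: (Y x + visser m (visser m x)) else 0.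

Fixpoint visser_bound n : R :=
  if n is m.+1 then 2^-1 * (1 + visser_bound m ^+ 2) else 0.

Local Notation Q := visser.
Local Notation q := visser_bound.

Lemma visser_bound_itv n : 0 <= q n <= 1.
Proof.
elim: n => [|n /andP[q0 q1]] /=; first by rewrite lexx ler01.
have q2 : q n ^+ 2 <= 1 by rewrite expr_le1.
by have := exprn_ge0 2 q0; lra.
Qed.

Lemma visser_linear n : linear (Q n).
Proof.
elim: n => [|n IH] a u v /=; first by rewrite scaler0 addr0.
rewrite linearP !IH [in RHS]scalerA mulrC -[in RHS]scalerA -[in RHS]scalerDr.
by congr (_ *: _); rewrite scalerDr addrACA.
Qed.

Lemma visserB n u v : Q n (u - v) = Q n u - Q n v.
Proof.
have := visser_linear n (-1) v u.
by rewrite !scaleN1r [u - v]addrC => ->; rewrite addrC.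
Qed.

Hypothesis Ycontr : contractive Y.

Lemma visser_norm n x : `|Q n x| <= toC (q n) * `|x|.
Proof.
elim: n x => [|n IH] x /=; first by rewrite normr0 rmorph0 mul0r.
have q0 : 0 <= toC (q n) by rewrite ler0c; case/andP: (visser_bound_itv n).
rewrite normrZ rmorphM fmorphV rmorph_nat rmorphD rmorph1 rmorphXn/=.
rewrite ger0_norm ?invr_ge0// -mulrA ler_wpM2l ?invr_ge0// mulrDl mul1r.
rewrite (le_trans (ler_normD _ _))// lerD// (le_trans (IH _))// expr2 -mulrA.
by rewrite ler_wpM2l.
Qed.

Lemma visser_contractive n : contractive (Q n).
Proof.
move=> x; rewrite (le_trans (visser_norm n x))// ler_piMl//.
by rewrite -(rmorph1 toC) lecR; case/andP: (visser_bound_itv n).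
Qed.

Lemma visser_bound_nd n : q n <= q n.+1.
Proof.
rewrite /= -subr_ge0 (_ : _ - _ = 2^-1 * (1 - q n) ^+ 2); last by field.
by rewrite mulr_ge0 ?invr_ge0// sqr_ge0.
Qed.

(** With [P = Q n.+1] and [Q = Q n], the difference of squares splits as [(P - Q) P + Q (P - Q)].
    The scalar iteration splits in the same way, so the induction compares term by term. *)
Lemma visser_step n x : `|Q n.+1 x - Q n x| <= toC (q n.+1 - q n) * `|x|.
Proof.
elim: n x => [|n IH] x.
  rewrite /= !subr0 addr0 expr0n addr0 mulr1 normrZ ger0_norm ?invr_ge0//.
  by rewrite fmorphV rmorph_nat ler_wpM2l ?invr_ge0.
have -> : Q n.+2 x - Q n.+1 x =
    2^-1 *: ((Q n.+1 (Q n.+1 x) - Q n (Q n.+1 x)) + Q n (Q n.+1 x - Q n x)).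
  rewrite visserB subrKA [Q n.+2 x]/(2^-1 *: (Y x + Q n.+1 (Q n.+1 x))).
  by rewrite {2}[Q n.+1 x]/= -scalerBr opprD addrACA subrr add0r.
have -> : q n.+2 - q n.+1 =
    2^-1 * ((q n.+1 - q n) * q n.+1 + q n * (q n.+1 - q n)).
  rewrite -[q n.+2]/(2^-1 * (1 + q n.+1 ^+ 2)).
  have {2}-> : q n.+1 = 2^-1 * (1 + q n ^+ 2) by [].
  by ring.
rewrite normrZ ger0_norm ?invr_ge0// (rmorphM toC) fmorphV rmorph_nat -mulrA.
rewrite ler_wpM2l ?invr_ge0// (le_trans (ler_normD _ _))//.
have qn0 : 0 <= toC (q n) by rewrite ler0c; case/andP: (visser_bound_itv n).
rewrite rmorphD (rmorphM toC (q n.+1 - q n)) (rmorphM toC (q n)) mulrDl lerD//.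
  apply: le_trans (IH _) _; rewrite -mulrA; apply: ler_wpM2l.
    by rewrite ler0c subr_ge0 visser_bound_nd.
  exact: visser_norm.
by apply: le_trans (visser_norm _ _) _; rewrite -mulrA ler_wpM2l.
Qed.

Hypothesis Ysym : forall x y, inner (Y x) y = inner x (Y y).

Lemma visser_sym n x y : inner (Q n x) y = inner x (Q n y).
Proof.
elim: n x y => [|n IH] x y /=; first by rewrite inner0l inner0r.
rewrite innerZl innerZr fmorphV rmorph_nat innerDl innerDr Ysym.
by rewrite !IH.
Qed.

(* With [L = (Y + L^2) / 2] the operator [1 - L] squares to [1 - Y]. *)
Lemma visser_limit : exists L : {linear H -> H},
  [/\ contractive L, forall x y, inner (L x) y = inner x (L y) &
      forall x, L x *+ 2 = Y x + L (L x)].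
Proof.
have /choice[L QL] x : exists l : H, Q n x @[n --> \oo] --> l.
  apply/cvg_ex.
  have /complex_realP[s xs] : `|x| \is Num.real by exact: normr_real.
  have s0 : 0 <= s by rewrite -ler0c -xs.
  apply: (@dominated_cvg _ _ _ (fun n => q n * s) s) => n.
    by rewrite -mulrBl rmorphM/= -xs; exact: visser_step.
  by rewrite ler_piMl//; case/andP: (visser_bound_itv n).
have Llin : linear L.
  move=> a u v; apply: lim_eq (QL _) _.
  under eq_fun do rewrite visser_linear.
  exact: cvgD (cvgZl_tmp (QL u)) (QL v).
have Lcontr : contractive L.
  by move=> x; apply: lim_norm_le (QL x) _ => n; exact: visser_contractive.
have [L' L'E] := linear_of Llin; exists L'; split => [x|x y|x].
- by rewrite L'E.
- rewrite !L'E.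
  have hl : inner (Q n x) y @[n --> \oo] --> inner (L x) y by exact: inner_cvgl.
  have hr : inner x (Q n y) @[n --> \oo] --> inner x (L y) by exact: inner_cvgr.
  rewrite (_ : (fun n => _) = fun n => inner x (Q n y)) in hl; last first.
    by apply/funext => n; exact: visser_sym.
  exact: (@lim_eq _ K^o (fun n => inner x (Q n y)) _ _ hl hr).
- rewrite !L'E.
  (* Since each [Q n] is a contraction, [Q n (Q n x)] and [Q n (L x)] differ by at most
     [|Q n x - L x|]. *)
  have QQL : Q n (Q n x) @[n --> \oo] --> L (L x).
    apply/cvgrPdist_lt => e e0; have e20 : 0 < e / 2 by rewrite divr_gt0.
    have /cvgrPdist_lt/(_ _ e20) h1 := QL (L x).
    have /cvgrPdist_lt/(_ _ e20) h2 := QL x.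
    near=> n; rewrite -(subrK (Q n (L x)) (L (L x))) -addrA -visserB.
    rewrite (le_lt_trans (ler_normD _ _))// [e]splitr ltrD//; first by near: n.
    by rewrite (le_lt_trans (visser_contractive _ _))//; near: n.
  have Q1L : Q n.+1 x @[n --> \oo] --> L x.
    by have := QL x; rewrite -cvg_shiftS.
  have h1 : Q n.+1 x *+ 2 @[n --> \oo] --> L x *+ 2 by exact: cvgMn.
  have h2 : Q n.+1 x *+ 2 @[n --> \oo] --> Y x + L (L x).
    rewrite (_ : (fun n => _) = fun n => Y x + Q n (Q n x)).
      exact: cvgD (cvg_cst _) QQL.
    apply/funext => n /=.
    by rewrite -scaler_nat scalerA divff ?pnatr_eq0// scale1r.
  exact: lim_eq h1 h2.
Unshelve. all: by end_near. Qed.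

Hypothesis Ypos : forall x, 0 <= inner (Y x) x.

(** The root [1 - L] satisfies the description, being positive because [L] is a contraction. For
    whichever root is selected, symmetry follows from positivity by polarization, and contractivity
    from [|S x|^2 = |x|^2 - <x, Y x>]. *)
Lemma psqrtP : let S := psqrt (idfun \- Y) in
  [/\ contractive S, forall x, 0 <= inner (S x) x,
      forall x y, inner (S x) y = inner x (S y) &
      forall x, S (S x) = x - Y x].
Proof.
move=> S.
pose A := [set S : {linear H -> H} | [/\ continuous S,
  forall x, 0 <= inner (S x) x & forall x, S (S x) = (idfun \- Y) x]].
have [_ S0 SS] : A S.
  suff : A !=set0 by move=> /(xgetPex (\0 : {linear H -> H})).
  have [L [Lc Ls LL]] := visser_limit.
  exists (idfun \- L); split => [|x|x] /=.
  - by move=> x; apply: cvgB; [exact: cvg_id|exact: contractive_continuous].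
  - have Lr : inner (L x) x \is Num.real by rewrite CrealE -innerC Ls.
    rewrite innerBl subr_ge0 (le_trans (real_ler_norm Lr))//.
    by rewrite (le_trans (ler_inner _ _))// innerE expr2 ler_wpM2r.
  - have -> : Y x = L x *+ 2 - L (L x) by rewrite LL addrK.
    rewrite linearB/= !opprB mulr2n -addrA; congr (_ + _).
    by rewrite opprD addrCA.
have Ssym := real_form_sym (fun x => ger0_real (S0 x)).
split=> //; apply/contractiveP => x.
by rewrite Ssym SS innerBr lerBlDr lerDl innerC conjC_ge0.
Qed.

End SquareRoot.

(** * Intertwining of positive square roots *)

Section Intertwining.
Context {R : realType} {H H' : hilbertType R}.
Local Notation K := R[i].
Variables (S : {linear H -> H}) (S' : {linear H' -> H'}) (A : {linear H -> H'}).
Hypotheses (Sc : contractive S) (S'c : contractive S') (Ac : contractive A).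
Hypotheses (Ssym : forall x y, inner (S x) y = inner x (S y))
  (S'sym : forall x y, inner (S' x) y = inner x (S' y)).
Hypotheses (S0 : forall x, 0 <= inner (S x) x)
  (S'0 : forall x, 0 <= inner (S' x) x).

(** From [0 <= S <= 1] comes [S^2 <= S], because [S - S^2 = (1 - S) S (1 - S) + S (1 - S) S]; hence
    [(1 - S)^2 <= 1 - S <= 1]. *)
Lemma sub_contractive x : `|x - S x| <= `|x|.
Proof.
have h y : 0 <= inner y y - inner (S y) y.
  rewrite subr_ge0 (le_trans (real_ler_norm (ger0_real (S0 y))))//.
  by rewrite (le_trans (ler_inner _ _))// innerE expr2 ler_wpM2r.
have SS : inner (S x) (S x) <= inner (S x) x.
  rewrite -subr_ge0; apply: le_trans (addr_ge0 (S0 (x - S x)) (h (S x))) _.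
  rewrite !(linearB S)/= !innerBl !innerBr [inner (S (S x)) x]Ssym.
  by rewrite le_eqVlt; apply/orP; left; apply/eqP; ring.
rewrite -ler_sqr ?nnegrE// -!innerE !innerBl !innerBr -[inner x (S x)]Ssym.
rewrite -subr_ge0 opprB addrA.
have -> : inner x x + (inner (S x) x - inner (S x) (S x)) -
  (inner x x - inner (S x) x) =
  (inner (S x) x - inner (S x) (S x)) + inner (S x) x.
  by ring.
by rewrite addr_ge0// subr_ge0.
Qed.

(** Positivity of [S'] gives [|z + S' z|^2 >= |z|^2 + |S' z|^2]. Applied to [S' z] it shows that
    [|S' z|] never decreases along the iteration, so each step adds at least [|S' y|^2]. *)
Lemma one_add_growth y n :
  n%:R * `|S' y| ^+ 2 <= `|iter n (fun z => z + S' z) y| ^+ 2.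
Proof.
suff : n%:R * `|S' y| ^+ 2 <= `|iter n (fun z => z + S' z) y| ^+ 2 /\
    `|S' y| <= `|S' (iter n (fun z => z + S' z) y)| by case.
have step z : `|z| ^+ 2 + `|S' z| ^+ 2 <= `|z + S' z| ^+ 2.
  rewrite -!innerE !innerDl !innerDr -[inner z (S' z)]S'sym.
  rewrite -subr_ge0 (_ : _ - _ = inner (S' z) z + inner (S' z) z).
    by rewrite addr_ge0.
  by ring.
elim: n => [|n [IH1 IH2]] /=; first by rewrite mul0r exprn_ge0.
split; last first.
  apply: le_trans IH2 _; rewrite linearD -ler_sqr ?nnegrE//.
  by apply: le_trans (step _); rewrite lerDl exprn_ge0.
apply: le_trans (step _); rewrite -addn1 natrD mulrDl mul1r lerD//.
by rewrite ler_sqr ?nnegrE.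
Qed.

(* If [S' Delta = - Delta S], then [(1 + S')^n Delta = Delta (1 - S)^n] stays
   bounded, which forces [S' Delta = 0]. *)
Lemma sqrt_intertwine : (forall x, S' (S' (A x)) = A (S (S x))) ->
  forall x, A (S x) = S' (A x).
Proof.
move=> SA.
pose D x := A (S x) - S' (A x).
have SD x : S' (D x) = - D (S x).
  by rewrite /D linearB/= SA opprB.
have DB u v : D (u - v) = D u - D v.
  by rewrite /D !(linearB S, linearB A, linearB S')/= !opprD !opprK addrACA.
have Dit n x :
    D (iter n (fun z => z - S z) x) = iter n (fun z => z + S' z) (D x).
  by elim: n => //= n <-; rewrite DB SD.
have Dle x : `|D x| <= 2 * `|x|.
  rewrite (le_trans (ler_normB _ _))// mulr_natl mulr2n lerD//.
    exact: le_trans (Ac _) (Sc _).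
  exact: le_trans (S'c _) (Ac _).
have itle n x : `|iter n (fun z => z - S z) x| <= `|x|.
  by elim: n => //= n; apply: le_trans; exact: sub_contractive.
have S'D x : S' (D x) = 0.
  apply/eqP/negPn/negP => S'D0.
  have s0 : 0 < `|S' (D x)| ^+ 2 by rewrite exprn_gt0// normr_gt0.
  have b0 : 0 < (2 * `|x|) ^+ 2 + 1 by rewrite ltr_wpDl// exprn_ge0// mulr_ge0.
  (* [N] is chosen so that [N.+1 * |S' (D x)|^2] exceeds [(2 * |x|)^2 + 1], against the bound on [D]
     along the iterates of [1 - S]. *)
  have [N /(_ N (leqnn N))] := inv_succ_small (divr_gt0 s0 b0).
  rewrite ltr_pdivlMr// ltr_pdivrMl//; apply/negP; rewrite -real_leNgt.
  - rewrite (le_trans (one_add_growth _ _))// -Dit.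
    apply: (@le_trans _ _ ((2 * `|x|) ^+ 2)); last by rewrite lerDl.
    rewrite ler_sqr ?nnegrE ?mulr_ge0// (le_trans (Dle _))// ler_wpM2l//.
  - by rewrite ger0_real// mulr_ge0// ltW.
  - by rewrite gtr0_real.
have DS x : D (S x) = 0 by apply/eqP; rewrite -oppr_eq0 -SD S'D.
(* [D'] is the adjoint of [D]. From [D S = 0] follows [S D' = 0], so [D D' = - S' A D']; pairing
   with [D D'] and using [S' D = 0] gives [D D' = 0], hence [D' = 0] and [D = 0]. *)
pose D' y := S (adjoint A y) - adjoint A (S' y).
have DD' x y : inner (D x) y = inner x (D' y).
  by rewrite /D /D' innerBl innerBr (adjointP Ac) Ssym S'sym (adjointP Ac).
have SD' y : S (D' y) = 0.
  by apply: inner_ext => x; rewrite inner0r -Ssym -DD' DS inner0l.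
have DD'0 y : D (D' y) = 0.
  apply: inner_eq0; rewrite {1}/D SD' linear0 sub0r innerNl S'sym S'D.
  by rewrite inner0r oppr0.
have D'0 y : D' y = 0 by apply: inner_eq0; rewrite -DD' DD'0 inner0l.
move=> x; apply/eqP; rewrite -subr_eq0; apply/eqP; apply: inner_ext => y.
by rewrite innerC -[A (S x) - _]/(D x) DD' D'0 !inner0r conjC0.
Qed.

End Intertwining.

(** * Defect operators and liftings *)

Section Defect.
Context {R : realType} {H : hilbertType R} (T : {linear H -> H}).
Hypothesis cT : contractive T.

Lemma defectP : [/\ contractive (defect T), forall x, 0 <= inner (defect T x) x,
  forall x y, inner (defect T x) y = inner x (defect T y) &
  forall x, defect T (defect T x) = x - adjoint T (T x)].
Proof.
apply: (psqrtP (Y := adjoint T \o T)) => [x|x y|x] /=.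
- exact: le_trans (adjoint_contractive cT _) (cT x).
- by rewrite -(adjointP cT) -(adjointC cT).
- by rewrite -(adjointC cT) inner_ge0.
Qed.

Lemma defect_starP : [/\ contractive (defect_star T),
  forall x, 0 <= inner (defect_star T x) x,
  forall x y, inner (defect_star T x) y = inner x (defect_star T y) &
  forall x, defect_star T (defect_star T x) = x - T (adjoint T x)].
Proof.
apply: (psqrtP (Y := T \o adjoint T)) => [x|x y|x] /=.
- exact: le_trans (cT _) (adjoint_contractive cT x).
- by rewrite (adjointC cT) (adjointP cT).
- by rewrite (adjointP cT) inner_ge0.
Qed.

Lemma inner_defect x y :
  inner (defect T x) (defect T y) = inner x y - inner (T x) (T y).
Proof.
by have [_ _ ds dd] := defectP; rewrite ds dd innerBr -(adjointP cT).
Qed.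

Lemma inner_defect_star x y : inner (defect_star T x) (defect_star T y) =
  inner x y - inner (adjoint T x) (adjoint T y).
Proof.
by have [_ _ ds dd] := defect_starP; rewrite ds dd innerBr (adjointC cT).
Qed.

Lemma defect_intertwine x : T (defect T x) = defect_star T (T x).
Proof.
have [dc d0 ds dd] := defectP; have [d'c d'0 d's d'd] := defect_starP.
apply: (sqrt_intertwine dc d'c cT ds d's d0 d'0) => y.
by rewrite dd d'd linearB.
Qed.

End Defect.

(** The best choice [t = c^* / p] breaks down at [p = 0], so [p] is enlarged to
    [r = p + e / (q + 1)], which costs at most [e] in the product with [q]. *)
Lemma quadratic_bound (R : realType) (c p q : R[i]) : 0 <= p -> 0 <= q ->
  (forall t, t * c + (t * c)^* <= `|t| ^+ 2 * p + q) -> `|c| ^+ 2 <= p * q.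
Proof.
move=> p0 q0 tc; apply/ler_addgt0Pr => e e0.
have q1 : 0 < q + 1 by rewrite ltr_wpDl.
pose r := p + e / (q + 1); have r0 : 0 < r by rewrite ltr_wpDl// divr_gt0.
have rr : r^* = r by apply/CrealP; exact: gtr0_real.
have := tc (r^-1 * c^*).
rewrite normrM norm_conjC normfV (gtr0_norm r0) !rmorphM/= fmorphV/= rr conjCK.
rewrite -!mulrA [c^* * c]mulrC -normCK -mulr2n => h.
have : `|c| ^+ 2 <= q * r.
  rewrite -ler_pdivrMr// [_ / _]mulrC -subr_ge0.
  move: h; rewrite -subr_ge0 => /le_trans; apply.
  rewrite -subr_ge0 (_ : _ - _ = (r^-1 * `|c|) ^+ 2 * (r - p)); last first.
    by field; rewrite gt_eqF.
  rewrite mulr_ge0 ?exprn_ge0 ?mulr_ge0 ?invr_ge0 ?(ltW r0)//.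
  by rewrite /r addrC addKr divr_ge0// ltW.
move=> /le_trans; apply; rewrite /r mulrDr mulrC lerD2l mulrCA -[leRHS]mulr1.
by rewrite ler_wpM2l ?(ltW e0)// ler_pdivrMr// mul1r lerDl.
Qed.

(** * Blocks of a contractive lifting and the contraction gamma *)

Section Lifting.
Context {R : realType} {HC HA : hilbertType R}.
Local Notation K := R[i].
Local Notation HE := (hsum HC HA).
Variables (C : {linear HC -> HC}) (E : {linear HE -> HE}).
Hypotheses (cC : contractive C) (cE : contractive E) (CE : is_lifting C E).
Local Notation A := (blockA E).
Local Notation B := (blockB E).

Lemma hsum_innerE (h k : HE) : inner h k = inner h.1 k.1 + inner h.2 k.2.
Proof. by []. Qed.

Lemma norm_in1 (x : HC) : `|in1 x : HE| = `|x|.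
Proof.
apply/eqP; rewrite -(eqrXn2 (n := 2))// -!innerE hsum_innerE/=.
by rewrite inner0l addr0.
Qed.

Lemma norm_in2 (x : HA) : `|in2 x : HE| = `|x|.
Proof.
apply/eqP; rewrite -(eqrXn2 (n := 2))// -!innerE hsum_innerE/=.
by rewrite inner0l add0r.
Qed.

Lemma blockA_contractive : contractive A.
Proof.
move=> x; apply: le_trans (le_hsum2 (E (in2 x))) _.
by rewrite -(norm_in2 x); exact: cE.
Qed.

Lemma blockB_contractive : contractive B.
Proof.
move=> x; apply: le_trans (le_hsum2 (E (in1 x))) _.
by rewrite -(norm_in1 x); exact: cE.
Qed.

Let cA := blockA_contractive.
Let cB := blockB_contractive.

Lemma lifting1 h : (E h).1 = C h.1. Proof. by rewrite CE. Qed.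

Lemma lifting2 h : (E h).2 = B h.1 + A h.2. Proof. by rewrite {1}CE. Qed.

(* [2 Re <B x, z> <= |D_C x|^2 + |D_{*,A} z|^2] because the difference is
   [|D_E (x, A^* z)|^2 + |B x + A A^* z - z|^2]. *)
Lemma blockB_bound x z :
  `|inner (B x) z| <= `|defect C x| * `|defect_star A z|.
Proof.
rewrite -ler_sqr ?nnegrE ?mulr_ge0// exprMn; apply: quadratic_bound.
- exact: exprn_ge0.
- exact: exprn_ge0.
(* By homogeneity [t] is absorbed into [x]. *)
move=> t; have -> : `|t| ^+ 2 * `|defect C x| ^+ 2 = `|defect C (t *: x)| ^+ 2.
  by rewrite linearZ/= normrZ exprMn.
rewrite -innerZl -linearZ/=; move: (t *: x) => {t}x.
rewrite -!innerE (inner_defect cC) (inner_defect_star cA) -subr_ge0.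
have := inner_ge0 (defect E (x, adjoint A z)); rewrite (inner_defect cE) => h.
apply: le_trans (addr_ge0 h (inner_ge0 (B x + A (adjoint A z) - z))) _.
rewrite !hsum_innerE/= !lifting1 !lifting2/= -innerC.
rewrite !innerBl !innerBr !innerDl !innerDr (adjointC cA (adjoint A z) z).
rewrite (adjointP cA (adjoint A z) z).
by rewrite le_eqVlt; apply/orP; left; apply/eqP; ring.
Qed.

(** [blockB_bound] is the hypothesis of [form_factor] for [B^*]; symmetry of [D_C] turns the
    resulting identity of forms into one of operators. *)
Lemma lifting_gammaP : contractive (lifting_gamma C E) /\
  forall y, adjoint B y =
    defect C (val (lifting_gamma C E (corestr (defect_star A) y))).
Proof.
pose P := [set g : {linear defect_star_space A -> defect_space C} |
    contractive g /\
    forall y, adjoint B y = defect C (val (g (corestr (defect_star A) y)))].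
suff : P !=set0.
  by move=> /(xgetPex (\0 : {linear defect_star_space A -> defect_space C})).
have [|x y|g [gc gB]] := form_factor (f := defect C) (g := defect_star A)
  (S := adjoint B).
- exact: linearP.
- by rewrite -(adjointP cB); exact: blockB_bound.
exists g; split=> // y; apply: inner_ext => x.
by have [_ _ ds _] := defectP cC; rewrite gB ds.
Qed.

End Lifting.

(** * Existence of the symbol and the action of its adjoint *)

Section Symbol.
Context {R : realType} {HC HA : hilbertType R}.
Local Notation K := R[i].
Local Notation HE := (hsum HC HA).
Variables (C : {linear HC -> HC}) (E : {linear HE -> HE}) (lam : K).
Hypotheses (cC : contractive C) (cE : contractive E) (CE : is_lifting C E).
Hypothesis lam1 : `|lam| < 1.
Local Notation A := (blockA E).
Local Notation B := (blockB E).
Local Notation g := (lifting_gamma C E).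
Local Notation DsA := (corestr (defect_star A)).
Local Notation Z := (opinv (idfun \- lam \*: adjoint A)).

Let cA : contractive A := blockA_contractive cE.
Let cB : contractive B := blockB_contractive cE.
Let cA' : contractive (adjoint A) := adjoint_contractive cA.

(** The contraction [g \o DsA] carries the Neumann series of [adjoint A] to this one. *)
Lemma resolvent_series (y : HA) :
  series (fun n => lam ^+ n *: g (DsA (iter n (adjoint A) y))) @ \oo -->
    g (DsA (Z y)).
Proof.
have [z [zP zy]] := neumann_cvg cA' lam1 y.
have -> : Z y = z by rewrite -zy; have [_ ->] := opinvP cA' lam1.
have [gc _] := lifting_gammaP cC cE CE; have [dc _ _ _] := defect_starP cA.
pose G : {linear HA -> defect_space C} := g \o DsA.
have Gc : contractive G by move=> x; rewrite (le_trans (gc _))//; exact: dc.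
have -> : series (fun n => lam ^+ n *: g (DsA (iter n (adjoint A) y))) =
    G \o series (fun n => lam ^+ n *: iter n (adjoint A) y).
  rewrite funeqE => n; rewrite /series/= !linear_sum; apply: eq_bigr => i _.
  by rewrite !linearZ.
exact: contractive_cvg Gc zP.
Qed.

Lemma resolvent_seriesS (y : HA) :
  series (fun n => lam ^+ n.+1 *: g (DsA (iter n (adjoint A) y))) @ \oo -->
    lam *: g (DsA (Z y)).
Proof.
have -> : series (fun n => lam ^+ n.+1 *: g (DsA (iter n (adjoint A) y))) =
    lam \*: series (fun n => lam ^+ n *: g (DsA (iter n (adjoint A) y))).
  rewrite funeqE => n; rewrite /series/= scaler_sumr; apply: eq_bigr => i _.
  by rewrite scalerA exprS.
exact: cvgZl_tmp (@resolvent_series y).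
Qed.

(** By [defect_intertwine] the vector is [D_{*,A} A h], so [insubd] does not fall back on its
    default 0. *)
Lemma defect_star_insubd (h : HA) : insubd 0 (A (defect A h)) = DsA (A h).
Proof.
by apply: val_inj; rewrite insubdK/= (defect_intertwine cA) ?corestr_subproof.
Qed.

(** Eliminates gamma: pairings with [D_C x] only involve the block [B]. *)
Lemma inner_gamma (x : HC) (y : HA) :
  inner (defect C x) (val (g (DsA y))) = inner (B x) y.
Proof.
have [_ gB] := lifting_gammaP cC cE CE; have [_ _ ds _] := defectP cC.
by rewrite ds -gB (adjointP cB).
Qed.

(** The sum of the two defining formulas of the symbol at [D_E h], with each series replaced by the
    resolvent [Z] of [adjoint A]. *)
Definition symbol_value (h : HE) : defect_space C :=
  (corestr (defect C) h.1 - g (DsA (Z (B h.1)))) +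
  (- g (DsA (A h.2)) + lam *: g (DsA (Z (defect A (defect A h.2))))).

(* [k] solves [(I - lam^* E) k = ((I - lam^* C) k.1, 0)]; the vector
   [defect E k] is the value at [defect C k.1] of the adjoint of the symbol. *)
Lemma inner_symbol_value (k h : HE) : k.2 = lam^* *: (E k).2 ->
  inner (defect C k.1) (val (symbol_value h)) = inner (defect E k) (defect E h).
Proof.
move=> k2; have [_ _ _ dd] := defectP cA; have [zK _] := opinvP cA' lam1.
(* [B k.1 = (E k).2 - A k.2 = (I - lam^* A) (E k).2], and the adjoint of [I - lam^* A] cancels
   [Z]. *)
have BZ y : inner (B k.1) (Z y) = inner (E k).2 y.
  have -> : B k.1 = (E k).2 - A k.2 by rewrite (lifting2 CE) addrK.
  rewrite innerBl (adjointP cA) k2 innerZl -innerZr.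
  by rewrite -[in RHS](zK y) innerBr.
rewrite /symbol_value !innerDr !innerNr innerZr !inner_gamma !BZ dd.
rewrite (inner_defect cC) (inner_defect cE) !hsum_innerE !(lifting1 CE).
have -> : lam^* * inner (E k).2 (h.2 - adjoint A (A h.2)) =
    inner k.2 h.2 - inner (A k.2) (A h.2).
  by rewrite k2 linearZ/= !innerZl innerBr -(adjointP cA) mulrBr.
have -> : inner (B k.1) (A h.2) = inner (E k).2 (A h.2) - inner (A k.2) (A h.2).
  by rewrite [(E k).2](lifting2 CE) innerDl addrK.
by rewrite [(E h).2](lifting2 CE) innerDr; ring.
Qed.

Lemma symbol_vector (x : HC) : exists k : HE,
  k.1 = x /\ k.2 = lam^* *: (E k).2.
Proof.
have l1 : `|lam^*| < 1 by rewrite norm_conjC.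
(* [b] solves [b = B x + lam^* A b], which makes it the second component of [E (x, lam^* b)]. *)
have [b [_ bE]] := neumann_cvg cA l1 (B x).
exists (x, lam^* *: b); split=> //=; rewrite (lifting2 CE)/= linearZ/=.
by rewrite -bE subrK.
Qed.

Lemma symbol_vector_norm (k : HE) : k.2 = lam^* *: (E k).2 ->
  `|defect E k| <= `|defect C k.1|.
Proof.
move=> k2; rewrite -ler_sqr ?nnegrE// -!innerE.
rewrite (inner_defect cE) (inner_defect cC).
rewrite !hsum_innerE (lifting1 CE) opprD addrACA gerDl subr_le0 k2 !innerE.
rewrite normrZ norm_conjC exprMn ler_piMl ?exprn_ge0//.
by rewrite exprn_ile1// ltW.
Qed.

Lemma symbol_value_norm h : `|symbol_value h| <= `|defect E h|.
Proof.
apply: clran_norm_le => // x; have [k [<- k2]] := symbol_vector x.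
rewrite (inner_symbol_value _ k2) mulrC (le_trans (ler_inner _ _))//.
by rewrite ler_wpM2r// symbol_vector_norm.
Qed.

Lemma symbol_value_linear : linear symbol_value.
Proof.
move=> a u v; apply: clran_ext => x; have [k [<- k2]] := symbol_vector x.
rewrite (inner_symbol_value _ k2) linearP innerDr innerZr.
by rewrite -!(inner_symbol_value _ k2) -innerZr -innerDr.
Qed.

(** By its norm bound, [symbol_value h] depends only on [D_E h] and extends to a contraction meeting
    the description. Any operator meeting it has these values, since [h = in1 h.1 + in2 h.2]. *)
Lemma lifting_symbolE : continuous (lifting_symbol C E lam) /\
  forall h, lifting_symbol C E lam (corestr (defect E) h) = symbol_value h.
Proof.
pose P := [set Th : {linear defect_space E -> defect_space C} |
    [/\ continuous Th,
        forall hc : HC, Th (corestr (defect E) (in1 hc)) =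
          corestr (defect C) hc -
          limn (series (fun n =>
            lam ^+ n *: g (DsA (iter n (adjoint A) (B hc))))) &
        forall ha : HA, Th (corestr (defect E) (in2 ha)) =
          - g (insubd 0 (A (defect A ha))) +
          limn (series (fun n => lam ^+ n.+1 *:
            g (DsA (iter n (adjoint A) (defect A (defect A ha))))))]].
have lim1 y : limn (series (fun n =>
    lam ^+ n *: g (DsA (iter n (adjoint A) y)))) = g (DsA (Z y)).
  exact: (cvg_lim (@norm_hausdorff _ _) (@resolvent_series y)).
have lim2 y : limn (series (fun n =>
    lam ^+ n.+1 *: g (DsA (iter n (adjoint A) y)))) = lam *: g (DsA (Z y)).
  exact: (cvg_lim (@norm_hausdorff _ _) (@resolvent_seriesS y)).
suff : P !=set0.
  move=> /(xgetPex (\0 : {linear defect_space E -> defect_space C})).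
  move=> [cTh Th1 Th2]; split=> // h.
  have -> : h = in1 h.1 + in2 h.2 :> HE.
    by case: h => h1 h2; congr pair; rewrite /= ?addr0 ?add0r.
  rewrite !linearD/= Th1 Th2 lim1 lim2 defect_star_insubd /symbol_value/=.
  by rewrite addr0 add0r.
have [V VE] := linear_of symbol_value_linear.
have [|G [Gc GV]] := clran_extend (f := defect E) (f0 := V).
  by move=> h; rewrite VE symbol_value_norm.
exists G; split=> [|h|h]; first exact: contractive_continuous.
- by rewrite GV VE lim1 /symbol_value/= !linear0 !addr0.
- by rewrite GV VE lim2 defect_star_insubd /symbol_value/= !linear0 addr0 add0r.
Qed.

Lemma inner_symbol (k h : HE) : k.2 = lam^* *: (E k).2 ->
  inner (defect C k.1) (val (lifting_symbol C E lam (corestr (defect E) h))) =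
  inner (defect E k) (defect E h).
Proof. by move=> k2; rewrite lifting_symbolE.2 inner_symbol_value. Qed.

End Symbol.

(** * Moebius transforms *)

Lemma scalar_lim_eq (K : numFieldType) (u v : nat -> K) (l m : K) :
  u @ \oo --> l -> v @ \oo --> m -> u =1 v -> l = m.
Proof.
move=> ul vm /funext uv; rewrite uv in ul.
rewrite -(cvg_lim (@norm_hausdorff _ K^o) ul).
exact: (cvg_lim (@norm_hausdorff _ K^o) vm).
Qed.

(** The map [f x |-> f' (J x)] is isometric on a dense subspace, hence extends. Its surjectivity
    comes from extending [f' y |-> f (J' y)] too, which gives a right inverse. *)
Lemma clran_unitary (R : realType) (H H' L L' : hilbertType R)
    (f : {linear H -> L}) (f' : {linear H' -> L'}) (J : {linear H -> H'})
    (J' : {linear H' -> H}) :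
  cancel J' J ->
  (forall x y, inner (f' (J x)) (f' (J y)) = inner (f x) (f y)) ->
  exists w : {linear clran f -> clran f'}, [/\ unitary_op w, contractive w &
    forall x, w (corestr f x) = corestr f' (J x)].
Proof.
move=> JK fJ.
have fJn x : `|f' (J x)| = `|f x|.
  by apply/eqP; rewrite -(eqrXn2 (n := 2))// -!innerE fJ.
have [|w [wc wf]] := clran_extend (f := f) (f0 := corestr f' \o J).
  by move=> y; rewrite [leLHS]fJn.
have [|w' [wc' wf']] := clran_extend (f := f') (f0 := corestr f \o J').
  by move=> y; rewrite [leLHS](_ : _ = `|f (J' y)|)// -fJn JK.
exists w; split=> //; split.
  (* The isometry passes to the closure in one variable at a time. *)
  have dense x y : inner (w (corestr f x)) (w y) = inner (corestr f x) y.
    have [v vy] := clran_seq y.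
    have h1 := inner_cvgr (z := corestr f x) vy.
    have wv : w (corestr f (v n)) @[n --> \oo] --> w y.
      exact: contractive_cvg wc vy.
    have h2 := inner_cvgr (z := w (corestr f x)) wv.
    by apply: (scalar_lim_eq h2 h1) => n /=; rewrite !wf; exact: fJ.
  move=> x y; have [v vx] := clran_seq x.
  have h1 := inner_cvgl (z := y) vx.
  have wv : w (corestr f (v n)) @[n --> \oo] --> w x.
    exact: contractive_cvg wc vx.
  have h2 := inner_cvgl (z := w y) wv.
  by apply: (scalar_lim_eq h2 h1) => n /=; exact: dense.
rewrite -subTset => z _; exists (w' z) => //.
have ww'c : continuous (w \o w').
  by apply: contractive_continuous => x /=; exact: le_trans (wc _) (wc' _).
apply: (clran_linear_ext (F := w \o w') (G := idfun)) => // [x|y].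
  exact: cvg_id.
by rewrite /= wf' wf /= JK.
Qed.

Section Moebius.
Context {R : realType} {H : hilbertType R}.
Local Notation K := R[i].
Variables (T : {linear H -> H}) (a : K).
Hypotheses (cT : contractive T) (a1 : `|a| < 1).
Local Notation J := (opinv (idfun \- a^* \*: T)).
Local Notation Ta := (moebius a T).

Lemma one_sub_norm_gt0 : 0 < 1 - `|a| ^+ 2.
Proof. by rewrite subr_gt0 exprn_ilt1. Qed.

Lemma resolventP : (forall x, J x - a^* *: T (J x) = x) /\
  forall x, J (x - a^* *: T x) = x.
Proof. by apply: opinvP => //; rewrite norm_conjC. Qed.

Lemma moebiusE k : Ta (k - a^* *: T k) = T k - a *: k.
Proof. by rewrite /moebius/= resolventP.2. Qed.

(** Both products on the left have the same cross terms, which cancel. *)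
Lemma moebius_inner k l :
  inner (k - a^* *: T k) (l - a^* *: T l) -
    inner (Ta (k - a^* *: T k)) (Ta (l - a^* *: T l)) =
  (1 - `|a| ^+ 2) * (inner k l - inner (T k) (T l)).
Proof.
rewrite !moebiusE normCK.
rewrite !innerBl !innerBr !innerZl !innerZr conjCK; ring.
Qed.

Lemma moebius_contractive : contractive Ta.
Proof.
apply/contractiveP => x; rewrite -(resolventP.1 x) -subr_ge0 moebius_inner.
rewrite mulr_ge0 ?(ltW one_sub_norm_gt0)// subr_ge0.
exact: (contractiveP T).1.
Qed.

Lemma moebius_defect_unitary :
  exists w : {linear defect_space Ta -> defect_space T},
  [/\ unitary_op w, contractive w & forall k,
    w (corestr (defect Ta) (k - a^* *: T k)) =
    sqrtC (1 - `|a| ^+ 2) *: corestr (defect T) k].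
Proof.
set s := sqrtC _.
have s0 : s != 0 by rewrite sqrtC_eq0 gt_eqF// one_sub_norm_gt0.
have ss : s^* * s = 1 - `|a| ^+ 2.
  have -> : s^* = s.
    apply/CrealP; rewrite ger0_real// sqrtC_ge0.
    exact/ltW/one_sub_norm_gt0.
  by rewrite -expr2 sqrtCK.
(* The factor [s] in front of the resolvent absorbs the constant of [moebius_inner], making the map
   isometric. *)
have [|x y|w [wu wc wJ]] := clran_unitary (f := defect Ta) (f' := defect T)
  (J := s \*: J) (J' := s^-1 \*: (idfun \- a^* \*: T)).
- by move=> x /=; rewrite !linearZ/= scalerN resolventP.2 scalerA mulVf ?scale1r.
- change (inner (defect T (s *: J x)) (defect T (s *: J y)) =
    inner (defect Ta x) (defect Ta y)).
  rewrite !(linearZ_LR (defect T))/=.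
  rewrite innerZl innerZr (inner_defect cT).
  rewrite (inner_defect moebius_contractive) mulrA [s * _]mulrC ss.
  by rewrite -moebius_inner !resolventP.1.
exists w; split=> // k.
rewrite wJ; change (corestr (defect T) (s *: J (k - a^* *: T k)) =
  s *: corestr (defect T) k).
by rewrite linearZ/= resolventP.2.
Qed.

End Moebius.

(** * Closed invariant subspaces *)

Section Subspaces.
Context {R : realType}.
Local Notation K := R[i].

Definition subspace (V : lmodType K) (D : set V) :=
  D 0 /\ forall c u v, D u -> D v -> D (c *: u + v).

Lemma lin_span_subspace (H : hilbertType R) (G : set H) : subspace (lin_span G).
Proof.
split.
  by exists 0%N, (fun _ => 0), (fun _ => 0); split; [case|rewrite big_ord0].
move=> c _ _ [m [cu [xu [Gu ->]]]] [n [cv [xv [Gv ->]]]].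
exists (m + n)%N.
exists (fun i : 'I_(m + n) =>
  match fintype.split i with inl j => c * cu j | inr j => cv j end).
exists (fun i : 'I_(m + n) =>
  match fintype.split i with inl j => xu j | inr j => xv j end).
split=> [i|]; first by case: fintype.split.
rewrite big_split_ord scaler_sumr; congr (_ + _); apply: eq_bigr => i _.
  by rewrite (unsplitK (inl i)) scalerA.
by rewrite (unsplitK (inr i)).
Qed.

Lemma sub_lin_span (H : hilbertType R) (G : set H) : G `<=` lin_span G.
Proof.
move=> x Gx; exists 1%N, (fun _ => 1), (fun _ => x); split=> //.
by rewrite big_ord1 scale1r.
Qed.

Lemma lin_span_min (H : hilbertType R) (G D : set H) :
  subspace D -> G `<=` D -> lin_span G `<=` D.
Proof.
move=> [D0 DD] GD _ [n [c [x [Gx ->]]]].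
elim/big_ind : _ => // [u v Du Dv|i _].
  by rewrite -[u]scale1r; exact: DD.
by rewrite -[_ *: _]addr0; apply: DD => //; exact: GD.
Qed.

Lemma closure_subspace (H : hilbertType R) (D : set H) :
  subspace D -> subspace (closure D).
Proof.
move=> [D0 DD]; split; first exact: subset_closure.
move=> c u v Du Dv B /nbhs_ballP[e /= e0 eB].
have e20 : 0 < e / 2 by rewrite divr_gt0.
have c0 : 0 < `|c| + 1 by rewrite ltr_wpDl.
have [u' [Du' uu']] := Du _ (nbhsx_ballx u _ (divr_gt0 e20 c0)).
have [v' [Dv' vv']] := Dv _ (nbhsx_ballx v _ e20).
exists (c *: u' + v'); split; first exact: DD.
apply: eB; move: uu' vv'; rewrite -!ball_normE/= => uu' vv'.
rewrite opprD addrACA -scalerBr (le_lt_trans (ler_normD _ _))// [e]splitr.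
rewrite ler_ltD// normrZ; apply: (@le_trans _ _ ((`|c| + 1) * `|u - u'|)).
  by rewrite ler_wpM2r// lerDl.
by rewrite mulrC -ler_pdivlMr// ltW.
Qed.

(** The partial sums of the Neumann series stay in [M], and so does their limit. *)
Lemma closed_neumann (H : hilbertType R) (T : {linear H -> H}) (l : K)
    (M : set H) :
  contractive T -> `|l| < 1 -> closed M -> subspace M ->
  (forall v, M v -> M (T v)) ->
  forall y, M y -> exists2 z, M z & z - l *: T z = y.
Proof.
move=> cT l1 Mc [M0 MD] MT y My; have [z [zP zy]] := neumann_cvg cT l1 y.
exists z => //; apply: (closed_cvg M Mc _ _ zP); apply: nearW => n.
rewrite /series/=; elim/big_ind : _ => // [u v Mu Mv|i _].
  by rewrite -[u]scale1r; exact: MD.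
rewrite -[_ *: _]addr0; apply: MD => //.
by elim: i => //= i; exact: MT.
Qed.

End Subspaces.

(** * Moebius transforms of minimal liftings *)

Section MoebiusLifting.
Context {R : realType} {HC HA : hilbertType R}.
Local Notation K := R[i].
Local Notation HE := (hsum HC HA).
Variables (C : {linear HC -> HC}) (E : {linear HE -> HE}) (a : K).
Hypotheses (cC : contractive C) (CE : contractive_lifting C E) (a1 : `|a| < 1).
Let cE : contractive E := CE.1.

(** For [h = (I - a^* E) k] the first components satisfy [h.1 = (I - a^* C) k.1], which gives the
    upper row. The lower row is additivity, its blocks being read off from the operator. *)
Lemma moebius_lifting : contractive_lifting (moebius a C) (moebius a E).
Proof.
split; first exact: moebius_contractive.
move=> h; rewrite [LHS]surjective_pairing; congr pair.
  rewrite -[h in LHS](resolventP cE a1).1; set k := opinv _ h.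
  rewrite (moebiusE cE a1).
  have -> : h.1 = k.1 - a^* *: C k.1.
    by rewrite -[h in LHS](resolventP cE a1).1 -/k -(lifting1 CE.2).
  by rewrite (moebiusE cC a1) -(lifting1 CE.2).
rewrite /blockB /blockA.
have {1}-> : h = in1 h.1 + in2 h.2 :> HE.
  by case: h => h1 h2; congr pair; rewrite /= ?addr0 ?add0r.
by rewrite (linearD (moebius a E) (in1 h.1) (in2 h.2)).
Qed.

(** The closed span [M] of the [E_a]-orbits is invariant under [E_a], hence under
    [E = (E_a + a) (I + a^* E_a)^{-1}]. It contains HC, so it contains the [E]-orbits, whose span is
    dense. *)
Lemma moebius_minimal : minimal_lifting E -> minimal_lifting (moebius a E).
Proof.
rewrite /minimal_lifting; set G := [set _ | _ in _ & _ in _] => GE.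
set Ga := [set _ | _ in _ & _ in _]; pose M := closure (lin_span Ga).
have cEa := moebius_contractive cE a1.
have Mc : closed M by exact: closed_closure.
have Ms : subspace M by apply: closure_subspace; exact: lin_span_subspace.
have MEa v : M v -> M (moebius a E v).
  (* The preimage of [M] is closed, so invariance need only be checked on the generators, where
     [E_a] raises [n] by one. *)
  have Dc : closed (moebius a E @^-1` M).
    by apply: closed_comp Mc => x _; exact: contractive_continuous.
  suff : lin_span Ga `<=` moebius a E @^-1` M.
    by move=> /closure_subset /(_ v); rewrite -((closure_id _).1 Dc); apply.
  apply: lin_span_min.
    split=> [|c u w Mu Mw].
      by change (M (moebius a E 0)); rewrite linear0; exact: Ms.1.
    by change (M (moebius a E (c *: u + w))); rewrite linearP; exact: Ms.2.
  move=> _ [n _ [x _ <-]]; apply/subset_closure/sub_lin_span.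
  by exists n.+1 => //; exists x.
have ME v : M v -> M (E v).
  move=> Mv; have la : `|- a^*| < 1 by rewrite normrN norm_conjC.
  have [z Mz <-] := closed_neumann cEa la Mc Ms MEa Mv.
  (* For [z = (I - a^* E) k] both sides equal [(1 - a^* a) E k]. *)
  have -> : E (z - (- a^*) *: moebius a E z) = a *: z + moebius a E z.
    have [k ->] : exists k, z = k - a^* *: E k.
      by exists (opinv (idfun \- a^* \*: E) z); rewrite (resolventP cE a1).1.
    rewrite (moebiusE cE a1).
    have -> : k - a^* *: E k - (- a^*) *: (E k - a *: k) = (1 - a^* * a) *: k.
      by rewrite scaleNr opprK scalerBr scalerA addrA subrK scalerBl scale1r.
    rewrite linearZ/= scalerBl scale1r scalerBr scalerA [RHS]addrC addrA subrK.
    by rewrite mulrC.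
  exact: Ms.2 _ _ _ Mz (MEa _ Mz).
have MG : G `<=` M.
  move=> _ [n _ [x _ <-]]; elim: n => [|n IH] /=; last exact: ME.
  by apply/subset_closure/sub_lin_span; exists 0%N => //; exists x.
apply/seteqP; split=> // x _.
have := closure_subset (lin_span_min Ms MG); rewrite -((closure_id _).1 Mc).
by apply; rewrite GE.
Qed.

End MoebiusLifting.

(** * The disc automorphism and the intertwining relation *)

Lemma disc_automorphism (R : realType) (a lam : R[i]) :
  `|a| < 1 -> `|lam| < 1 ->
  1 + a^* * lam != 0 /\ `|(lam + a) / (1 + a^* * lam)| < 1.
Proof.
move=> a1 l1.
have d0 : 1 + a^* * lam != 0.
  apply/negP => /eqP d0; have : `|a^* * lam| < 1.
    by rewrite normrM norm_conjC mulr_ilt1.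
  have -> : a^* * lam = -1 by apply/eqP; rewrite -addr_eq0 addrC d0.
  by rewrite normrN1 ltxx.
split=> //; rewrite normrM normfV ltr_pdivrMr ?normr_gt0// mul1r.
rewrite -ltr_sqr ?nnegrE// -subr_gt0.
have -> : `|1 + a^* * lam| ^+ 2 - `|lam + a| ^+ 2 =
    (1 - `|a| ^+ 2) * (1 - `|lam| ^+ 2).
  by rewrite !normCK !rmorphD/= rmorph1 rmorphM/= conjCK; ring.
by rewrite mulr_gt0// subr_gt0 exprn_ilt1.
Qed.

Lemma disc_automorphism_conj (R : realType) (a lam mu : R[i]) :
  1 + a^* * lam != 0 -> mu = (lam + a) / (1 + a^* * lam) ->
  mu^* - a^* = lam^* * (1 - a * mu^*).
Proof.
move=> d0 ->; rewrite rmorphM/= fmorphV/= !rmorphD/= rmorph1 rmorphM/= conjCK.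
have : (1 + a^* * lam)^* != 0 by rewrite conjC_eq0.
rewrite rmorphD/= rmorph1 rmorphM/= conjCK => d1.
by field.
Qed.

Theorem theorem5p2 (R : realType) (HC HA : hilbertType R)
    (C : {linear HC -> HC}) (E : {linear hsum HC HA -> hsum HC HA}) (a : R[i]) :
  contractive C -> contractive_lifting C E -> minimal_lifting E -> `|a| < 1 ->
  let Ca := moebius a C in let Ea := moebius a E in
  [/\ contractive_lifting Ca Ea, minimal_lifting Ea &
    exists (u : {linear defect_space Ea -> defect_space E})
           (w : {linear defect_space Ca -> defect_space C}),
      [/\ unitary_op u, unitary_op w &
        forall (lam : R[i]), `|lam| < 1 -> forall x : defect_space Ea,
          w (lifting_symbol Ca Ea lam x) =
          lifting_symbol C E ((lam + a) / (1 + a^* * lam)) (u x)]].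
Proof.
move=> cC CE Emin a1 Ca Ea; have cE := CE.1.
have CEa : contractive_lifting Ca Ea := moebius_lifting cC CE a1.
have cCa : contractive Ca := moebius_contractive cC a1.
split=> //; first exact: (moebius_minimal CE a1 Emin).
have [u [uu uc uE]] := moebius_defect_unitary cE a1.
have [w [wu wc wE]] := moebius_defect_unitary cC a1.
exists u, w; split=> // lam l1.
have [d0 m1] := disc_automorphism a1 l1.
set mu := (lam + a) / _ in m1 *.
have mulam : mu^* - a^* = lam^* * (1 - a * mu^*).
  exact: disc_automorphism_conj d0 erefl.
have [ca _] := lifting_symbolE cCa CEa.1 CEa.2 l1.
have [cm _] := lifting_symbolE cC cE CE.2 m1.
set s := sqrtC _ in uE wE.
have s0 : s != 0 by rewrite sqrtC_eq0 gt_eqF// one_sub_norm_gt0.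
(* Both sides are continuous, so it suffices to compare them on the range of the defect operator of
   [Ea]. *)
apply: (clran_linear_ext (F := w \o lifting_symbol Ca Ea lam)
                         (G := lifting_symbol C E mu \o u)).
- move=> x; apply: (@continuous_comp _ _ _ (lifting_symbol Ca Ea lam) w).
    exact: ca.
  exact: contractive_continuous wc _.
- move=> x; apply: (@continuous_comp _ _ _ u (lifting_symbol C E mu)).
    exact: contractive_continuous uc _.
  exact: cm.
move=> h /=; rewrite -[h](resolventP cE a1).1; set k0 := opinv _ h.
rewrite [in RHS]uE; apply: clran_ext => x.
(* The test vector [x] is the first component of the vector [k] attached to [E] and [mu]. *)
have [k [<- k2]] := symbol_vector cE CE.2 m1 x.
(* The factor [s] turns [D_C k.1] into a value of [w], so that unitarity of [w] applies. *)
apply: (mulfI s0).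
pose k' : hsum HC HA := k - a^* *: E k.
have k'1 : k'.1 = k.1 - a^* *: C k.1 by rewrite -(lifting1 CE.2).
have k'2 : k'.2 = lam^* *: (Ea k').2.
  rewrite (moebiusE cE a1).
  change (k.2 - a^* *: (E k).2 = lam^* *: ((E k).2 - a *: k.2)).
  rewrite k2 scalerA -scalerBl -{2}[(E k).2]scale1r -scalerBl scalerA.
  by rewrite mulam.
rewrite -innerZl.
(* The pairing for [Ea] at [lam] is the common value: [w] links it to the left side, [u] to the
   right side. *)
transitivity (inner (defect Ea k') (defect Ea (k0 - a^* *: E k0))).
  rewrite -(inner_symbol cCa CEa.1 CEa.2 l1)// k'1.
  transitivity (inner (w (corestr (defect Ca) (k.1 - a^* *: C k.1)))
    (w (lifting_symbol Ca Ea lam (corestr (defect Ea) (k0 - a^* *: E k0))))).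
    by rewrite wE.
  by rewrite wu.1.
transitivity (inner (u (corestr (defect Ea) k'))
    (u (corestr (defect Ea) (k0 - a^* *: E k0)))).
  by rewrite uu.1.
rewrite !uE (linearZ_LR (lifting_symbol C E mu))/= innerZl; congr (_ * _).
change (inner (defect E k) (s *: defect E k0) = inner (defect C k.1)
  (s *: val (lifting_symbol C E mu (corestr (defect E) k0)))).
by rewrite !innerZr (inner_symbol cC cE CE.2 m1).
Qed.
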